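(* Let $d\geq 2$ be an integer and let $S:\mathbb{R}^d\to\mathbb{R}^d$ be the quasiregular mapping described in the context. Then: (i) the periodic points of $S$ are dense in $\mathbb{R}^d$; (ii) $S$ has the blowing-up property everywhere in $\mathbb{R}^d$, that is, $\bigcup_{k=0}^\infty S^k(U)=\mathbb{R}^d$ for every non-empty open set $U\subseteq\mathbb{R}^d$. Equivalently, for every $x\in\mathbb{R}^d$ the backward orbit $O^-(x)=\bigcup_{k=0}^\infty S^{-k}(x)$ is dense in $\mathbb{R}^d$.
   Context: Fix $d\ge2$. Write $H_0=\{x\in\mathbb{R}^d: x_d=0\}$, $B(x,t)$ for the open Euclidean ball, and for a linear map $A$, $\ell(A)=\inf_{\|h\|=1}\|Ah\|$. Let $F$ be a bi-Lipschitz homeomorphism from the half-cube $[-1,1]^{d-1}\times[0,1]$ onto the closed upper half-ball $\{x:\|x\|\le1,x_d\ge0\}$ which maps the face $[-1,1]^{d-1}\times\{1\}$ onto the hemisphere $\{\|x\|=1,x_d\ge0\}$ (hence the remaining faces onto the flat disc in $H_0$), and with $F(0)=0$. Extend $F$ to the half-beam $T_0=[-1,1]^{d-1}\times[0,\infty)$ by $F(x)=e^{x_d-1}F(x_1,\dots,x_{d-1},1)$ for $x_d>1$, so $F$ maps $T_0$ onto $\{x_d\ge0\}$ with $F(\partial T_0)\subseteq H_0$. Then extend $F$ to all of $\mathbb{R}^d$ by repeated reflection: if $\rho$ is the reflection in a hyperplane containing a boundary face of a half-beam on which $F$ is already defined, set $F(\rho(x))=\tau(F(x))$, where $\tau(x_1,\dots,x_d)=(x_1,\dots,x_{d-1},-x_d)$.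 The resulting $F:\mathbb{R}^d\to\mathbb{R}^d$ is quasiregular with $\beta:=\operatorname{ess\,inf}_{x}\ell(DF(x))>0$. Choose $\lambda>4\sqrt{d-1}/\beta$ and set $S=\lambda F$; thus $\alpha:=\operatorname{ess\,inf}_x\ell(DS(x))=\lambda\beta>4\sqrt{d-1}>1$. Half-beams: for $r\in\mathcal{S}=\mathbb{Z}^{d-1}\times\{-1,1\}$, $T(r)=\{x: |x_j-2r_j|\le1\ (1\le j\le d-1),\ r_dx_d\ge0\}$; $S$ maps each $T(r)$ bijectively onto $\{x_d\ge0\}$ or $\{x_d\le0\}$. *)

(* Defs.v *)
From mathcomp Require Import ssreflect ssrfun ssrbool eqtype ssrnat seq choice fintype.
From Stdlib Require Import Reals.
Open Scope R_scope.

(* A point of R^d is represented as (y, t) with y : R^(d-1) (the first d-1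
   coordinates x_1..x_{d-1}) and t = x_d the last coordinate. *)
Definition vec (d : nat) : Type := (('I_(d.-1) -> R) * R)%type.

Section Vec.
Context {d : nat}.

Definition vzero : vec d := (fun _ => 0, 0).
Definition vadd (x y : vec d) : vec d := (fun i => fst x i + fst y i, snd x + snd y).
Definition vscale (c : R) (x : vec d) : vec d := (fun i => c * fst x i, c * snd x).
Definition vsub (x y : vec d) : vec d := vadd x (vscale (-1) y).

Definition sqnorm (x : vec d) : R :=
  foldr (fun i acc => Rsqr (fst x i) + acc) (Rsqr (snd x)) (enum 'I_(d.-1)).
Definition norm (x : vec d) : R := sqrt (sqnorm x).
Definition dist (x y : vec d) : R := norm (vsub x y).

Definition tau (x : vec d) : vec d := (fst x, - snd x).

Definition refl_coord (j : 'I_(d.-1)) (k : Z) (x : vec d) : vec d :=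
  (fun i => if i == j then 2 * (2 * IZR k + 1) - fst x i else fst x i, snd x).
Definition refl_last (x : vec d) : vec d := (fst x, - snd x).

Definition in_half_cube (x : vec d) : Prop :=
  (forall i, -1 <= fst x i <= 1) /\ 0 <= snd x <= 1.
Definition in_upper_half_ball (x : vec d) : Prop := norm x <= 1 /\ 0 <= snd x.
Definition in_upper_hemisphere (x : vec d) : Prop := norm x = 1 /\ 0 <= snd x.

Definition is_linear (A : vec d -> vec d) : Prop :=
  (forall u v, A (vadd u v) = vadd (A u) (A v)) /\
  (forall c u, A (vscale c u) = vscale c (A u)).

Definition diff_at (f : vec d -> vec d) (x : vec d) (A : vec d -> vec d) : Prop :=
  is_linear A /\
  forall eps, 0 < eps -> exists delta, 0 < delta /\
    forall h, norm h < delta ->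
      norm (vsub (vsub (f (vadd x h)) (f x)) (A h)) <= eps * norm h.

Definition ell_ge (A : vec d -> vec d) (c : R) : Prop :=
  forall h, norm h = 1 -> c <= norm (A h).

Definition in_box (a b x : vec d) : Prop :=
  (forall i, fst a i <= fst x i <= fst b i) /\ snd a <= snd x <= snd b.
Definition box_vol (a b : vec d) : R :=
  foldr (fun i acc => Rmax 0 (fst b i - fst a i) * acc)
        (Rmax 0 (snd b - snd a)) (enum 'I_(d.-1)).
Definition null_set (E : vec d -> Prop) : Prop :=
  forall eps, 0 < eps -> exists a b : nat -> vec d,
    (forall x, E x -> exists n, in_box (a n) (b n) x) /\
    (forall N, sum_f_R0 (fun n => box_vol (a n) (b n)) N <= eps).
Definition almost_everywhere (P : vec d -> Prop) : Prop :=
  null_set (fun x => ~ P x).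

Definition is_open (U : vec d -> Prop) : Prop :=
  forall x, U x -> exists r, 0 < r /\ forall y, dist y x < r -> U y.
Definition dense (E : vec d -> Prop) : Prop :=
  forall x eps, 0 < eps -> exists p, E p /\ dist p x < eps.
Definition iter (S : vec d -> vec d) (k : nat) (x : vec d) : vec d := Nat.iter k S x.
Definition periodic_point (S : vec d -> vec d) (x : vec d) : Prop :=
  exists n, (1 <= n)%nat /\ iter S n x = x.
Definition blowing_up_everywhere (S : vec d -> vec d) : Prop :=
  forall U, is_open U -> (exists u, U u) ->
    forall y, exists k x, U x /\ iter S k x = y.
Definition backward_orbit (S : vec d -> vec d) (x : vec d) (z : vec d) : Prop :=
  exists k, iter S k z = x.

Definition F_on_half_cube (F : vec d -> vec d) : Prop :=
  (exists L, 0 < L /\ forall x y, in_half_cube x -> in_half_cube y ->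
      dist x y <= L * dist (F x) (F y) /\ dist (F x) (F y) <= L * dist x y) /\
  (forall x, in_half_cube x -> in_upper_half_ball (F x)) /\
  (forall z, in_upper_half_ball z -> exists x, in_half_cube x /\ F x = z) /\
  (forall x, in_half_cube x -> snd x = 1 -> in_upper_hemisphere (F x)) /\
  (forall z, in_upper_hemisphere z ->
      exists x, in_half_cube x /\ snd x = 1 /\ F x = z) /\
  F vzero = vzero.

Definition F_on_half_beam (F : vec d -> vec d) : Prop :=
  forall x, (forall i, -1 <= fst x i <= 1) -> 1 < snd x ->
    F x = vscale (exp (snd x - 1)) (F (fst x, 1)).

(* extension by repeated reflection: F o rho = tau o F for the reflections rho
   in all hyperplanes containing boundary faces of half-beams *)
Definition F_reflection (F : vec d -> vec d) : Prop :=
  (forall j k x, F (refl_coord j k x) = tau (F x)) /\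
  (forall x, F (refl_last x) = tau (F x)).

End Vec.

(* Main.v *)
(* The inverse [g] of F on the half-beam T_0 is Lipschitz with an unspecified
   constant and, off a null set (the image under F of the exceptional set), has
   pointwise dilation at most 1 / beta.  Fubini on axis-parallel segments turns
   this into |g z - g w| <= (1 / beta) |z - w|_1.  The l^1 norm costs a factor
   sqrt d, so inverse branches of S contract by kappa = sqrt d / (lambda beta),
   which is less than 1 because lambda beta > 4 sqrt (d - 1).

   Follow a point x for n steps to a half-beam.  Within distance 2 of S^n x there
   is a point p on a vertical face, so S p lies in H_0 and S^2 p in the disc of
   radius lambda.  Pulling back along the orbit gives inverse branches of S^(n+2)
   that contract by kappa^(n+2) and send S^2 p near x.  Since faces of two
   half-beams meet, such a branch may be chosen on the half-space containing any
   given z, and it sends z near x: backward orbits are dense.  With z = x the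
   branch is a contraction of a half-space that nearly fixes x, so its fixed
   point is a periodic point near x. *)

From Stdlib Require Import List ZArith.
Require Import Defs.
From mathcomp Require Import ssreflect ssrfun ssrbool eqtype ssrnat seq choice fintype.
From Stdlib Require Import Reals.
From Stdlib Require Import Lra Lia ClassicalEpsilon FunctionalExtensionality.
Open Scope R_scope.

(** * Finite sums and Euclidean vectors *)

Definition rsum {A : Type} (l : list A) (f : A -> R) : R :=
  foldr (fun i acc => f i + acc) 0 l.
Definition rprod {A : Type} (l : list A) (f : A -> R) : R :=
  foldr (fun i acc => f i * acc) 1 l.

Section Sums.
Variable A : Type.
Implicit Types (l : list A) (f g : A -> R).

Lemma rsum_le l f g : (forall i, In i l -> f i <= g i) -> rsum l f <= rsum l g.
Proof.
  elim: l => [|a l IH] H /=; first by apply: Rle_refl.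
  apply: Rplus_le_compat; first by apply: H; left.
  by apply: IH => i Hi; apply: H; right.
Qed.

Lemma rsum_eq l f g : (forall i, In i l -> f i = g i) -> rsum l f = rsum l g.
Proof.
  move=> H; apply: Rle_antisym; apply: rsum_le => i /H ->; exact: Rle_refl.
Qed.

Lemma rsum_plus l f g : rsum l (fun i => f i + g i) = rsum l f + rsum l g.
Proof. elim: l => [|a l IH] /=; [|rewrite IH]; lra. Qed.

Lemma rsum_scal l c f : rsum l (fun i => c * f i) = c * rsum l f.
Proof. elim: l => [|a l IH] /=; [|rewrite IH]; lra. Qed.

Lemma rsum_const l c : rsum l (fun=> c) = INR (length l) * c.
Proof.
  elim: l => [|a l IH]; first by rewrite /=; lra.
  change (c + rsum l (fun=> c) = INR (Datatypes.S (length l)) * c).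
  rewrite S_INR IH; lra.
Qed.

Lemma rsum_ge0 l f : (forall i, In i l -> 0 <= f i) -> 0 <= rsum l f.
Proof.
  move=> H; rewrite -(Rmult_0_r (INR (length l))) -rsum_const; exact: rsum_le.
Qed.

Lemma rsum_cat l l' f : rsum (l ++ l')%list f = rsum l f + rsum l' f.
Proof. elim: l => [|a l IH] /=; [|rewrite IH]; lra. Qed.

Lemma rsum_ge_term l f i :
  (forall j, In j l -> 0 <= f j) -> In i l -> f i <= rsum l f.
Proof.
  move=> H /(in_split _ _) [l1 [l2 E]]; rewrite E rsum_cat /=.
  have := rsum_ge0 l1 f; have := rsum_ge0 l2 f => H2 H1.
  have := H1 _; have := H2 _ => {H1 H2}.
  have P1: forall j, In j l1 -> 0 <= f j.
    by move=> j Hj; apply: H; rewrite E; apply: in_or_app; left.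
  have P2: forall j, In j l2 -> 0 <= f j.
    by move=> j Hj; apply: H; rewrite E; apply: in_or_app; right; right.
  move=> /(_ P2) ? /(_ P1) ?; lra.
Qed.

Lemma rprod_ge0 l f : (forall i, In i l -> 0 <= f i) -> 0 <= rprod l f.
Proof.
  elim: l => [|a l IH] H /=; first lra.
  apply: Rmult_le_pos; first by apply: H; left.
  by apply: IH => i Hi; apply: H; right.
Qed.

Lemma rprod_const l c : rprod l (fun=> c) = c ^ length l.
Proof. by elim: l => [|a l IH] //=; rewrite IH. Qed.

Lemma rprod_split l1 l2 j f :
  rprod (l1 ++ j :: l2)%list f = f j * rprod (l1 ++ l2)%list f.
Proof. elim: l1 => [|a l IH] //=; rewrite IH; lra. Qed.

(** In the induction step the cross term [2 * (u * v * X)] is at most [u * u * Q + v * v * P]: by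
    induction [X * X <= P * Q], and then the arithmetic-geometric mean inequality applies to the
    squares. *)
Lemma cauchy_schwarz l f g :
  Rsqr (rsum l (fun i => f i * g i)) <=
  rsum l (fun i => Rsqr (f i)) * rsum l (fun i => Rsqr (g i)).
Proof.
  elim: l => [|a l IH] /=; first by rewrite Rsqr_0; lra.
  have HF: 0 <= rsum l (fun i => Rsqr (f i)) by apply: rsum_ge0 => *; apply: Rle_0_sqr.
  have HG: 0 <= rsum l (fun i => Rsqr (g i)) by apply: rsum_ge0 => *; apply: Rle_0_sqr.
  move: IH HF HG; set X := rsum l _; set P := rsum l _; set Q := rsum l _.
  move: (f a) (g a) => u v; rewrite /Rsqr => IH HP HQ.
  have HY: 0 <= u * u * Q + v * v * P by nra.
  have HZ: (2 * (u * v * X)) * (2 * (u * v * X))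
           <= (u * u * Q + v * v * P) * (u * u * Q + v * v * P).
    have : (u * v) * (u * v) * (X * X) <= (u * v) * (u * v) * (P * Q).
      by apply: Rmult_le_compat_l => //; nra.
    have := Rle_0_sqr (u * u * Q - v * v * P); rewrite /Rsqr; nra.
  have : 2 * (u * v * X) <= u * u * Q + v * v * P.
    by apply: Rsqr_incr_0_var.
  nra.
Qed.

(* Infinite sums are sums over an exhaustion [L] by finite lists. *)
Definition exhaustion (L : nat -> list A) : Prop :=
  forall M N, le M N -> exists l, L N = (L M ++ l)%list.

Lemma rsum_exhaustion L M N f :
  exhaustion L -> le M N -> (forall i, 0 <= f i) -> rsum (L M) f <= rsum (L N) f.
Proof.
  move=> E /E [l ->] Hf; rewrite rsum_cat.
  have : 0 <= rsum l f by apply: rsum_ge0.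
  lra.
Qed.

Lemma exhaustion_concat (l : nat -> list A) :
  exhaustion (fun N => concat (List.map l (List.seq 0 N))).
Proof.
  move=> M N H; exists (concat (List.map l (List.seq M (N - M)%coq_nat))).
  rewrite -concat_app -List.map_app -seq_app; do 3 f_equal; lia.
Qed.

Lemma concat_seq_S (l : nat -> list A) N :
  concat (List.map l (List.seq 0 (Datatypes.S N))) = (concat (List.map l (List.seq 0 N)) ++ l N)%list.
Proof. by rewrite seq_S List.map_app concat_app /= List.app_nil_r. Qed.

End Sums.

Section Vectors.
Context {d : nat}.
Local Notation J := (option 'I_(d.-1)).
Implicit Types (x y z : vec d).

(** The index [None] stands for the last coordinate, so that all coordinates are treated alike. *)
Definition crd x (j : J) : R := if j is Some i then fst x i else snd x.
Definition vec_of (f : J -> R) : vec d := (fun i => f (Some i), f None).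
Definition axes : list J := (List.map Some (enum 'I_(d.-1)) ++ [:: None])%list.

Lemma crd_vec_of f j : crd (vec_of f) j = f j.
Proof. by case: j. Qed.

Lemma vec_ext x y : (forall j, crd x j = crd y j) -> x = y.
Proof.
  case: x => [a s]; case: y => [b t] H; f_equal; last by have := H None.
  by apply: functional_extensionality => i; have := H (Some i).
Qed.

Lemma in_mem (T : eqType) (s : list T) (a : T) : a \in s -> In a s.
Proof.
  by elim: s => [|b s IH] //; rewrite in_cons => /orP [/eqP->|/IH]; [left|right].
Qed.

Lemma mem_in (T : eqType) (s : list T) (a : T) : In a s -> a \in s.
Proof.
  elim: s => [|b s IH] //= [->|/IH H]; rewrite in_cons ?eqxx //.
  by rewrite H orbT.
Qed.

Lemma NoDup_uniq (T : eqType) (s : list T) : uniq s -> NoDup s.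
Proof.
  elim: s => [|b s IH] /=; first by move=> _; constructor.
  move=> /andP [Hb /IH Hs]; constructor => // /mem_in; exact/negP.
Qed.

Lemma in_axes (j : J) : In j axes.
Proof.
  apply: in_or_app; case: j => [i|]; last by right; left.
  by left; apply: List.in_map; apply: in_mem; rewrite mem_enum.
Qed.

Lemma NoDup_axes : NoDup axes.
Proof.
  apply: NoDup_app.
  - apply: NoDup_map_NoDup_ForallPairs; last by apply: NoDup_uniq; apply: enum_uniq.
    by move=> a b _ _ [].
  - by repeat constructor.
  - by move=> a /in_map_iff [i [<- _]] [].
Qed.

Lemma length_axes : length axes = (d.-1).+1.
Proof.
  rewrite length_app length_map /=.
  have -> : length (enum 'I_(d.-1)) = d.-1 by apply: size_enum_ord.
  lia.
Qed.

(** [None] comes last in [axes], hence is the innermost term of the fold, which is where [sqnorm]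
    and [box_vol] put the last coordinate. *)
Lemma foldr_axes (op : R -> R -> R) (e : R) (f : J -> R) :
  foldr (fun j acc => op (f j) acc) e axes =
  foldr (fun i acc => op (f (Some i)) acc) (op (f None) e) (enum 'I_(d.-1)).
Proof.
  rewrite /axes; elim: (enum _) => [|i l IH] //=.
  by rewrite -IH.
Qed.

Lemma sqnormE x : sqnorm x = rsum axes (fun j => Rsqr (crd x j)).
Proof. by rewrite /rsum (foldr_axes Rplus) /= Rplus_0_r. Qed.

Lemma box_volE (a b : vec d) :
  box_vol a b = rprod axes (fun j => Rmax 0 (crd b j - crd a j)).
Proof. by rewrite /rprod (foldr_axes Rmult) /= Rmult_1_r. Qed.

Lemma in_boxE (a b x : vec d) :
  in_box a b x <-> forall j, crd a j <= crd x j <= crd b j.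
Proof.
  split; first by move=> [H1 H2] [i|] /=; [exact: H1|exact: H2].
  move=> H; split; [move=> i; exact: (H (Some i))|exact: (H None)].
Qed.

Lemma crd_vadd x y j : crd (vadd x y) j = crd x j + crd y j.
Proof. by case: j. Qed.

Lemma crd_vscale c x j : crd (vscale c x) j = c * crd x j.
Proof. by case: j. Qed.

Lemma crd_vsub x y j : crd (vsub x y) j = crd x j - crd y j.
Proof. rewrite /vsub crd_vadd crd_vscale; lra. Qed.

Definition crdE := (crd_vsub, crd_vadd, crd_vscale, crd_vec_of).

Lemma sqnorm_ge0 x : 0 <= sqnorm x.
Proof. rewrite sqnormE; apply: rsum_ge0 => *; exact: Rle_0_sqr. Qed.

Lemma norm_ge0 x : 0 <= norm x.
Proof. exact: sqrt_pos. Qed.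

Lemma norm_sqr x : norm x * norm x = sqnorm x.
Proof. by apply: sqrt_sqrt; apply: sqnorm_ge0. Qed.

Lemma norm_le_sqr x c : 0 <= c -> sqnorm x <= c * c -> norm x <= c.
Proof. by move=> Hc H; apply: Rsqr_incr_0_var => //; rewrite /Rsqr norm_sqr. Qed.

Lemma crd_le_norm x j : Rabs (crd x j) <= norm x.
Proof.
  apply: Rsqr_incr_0_var; last exact: norm_ge0.
  rewrite /Rsqr norm_sqr -Rabs_mult Rabs_pos_eq; last by nra.
  rewrite sqnormE; apply: (rsum_ge_term _ _ (fun j => Rsqr (crd x j))); last exact: in_axes.
  move=> *; exact: Rle_0_sqr.
Qed.

Lemma norm_le_sum_abs x : norm x <= rsum axes (fun j => Rabs (crd x j)).
Proof.
  have Hpos l : 0 <= rsum l (fun j => Rabs (crd x j)).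
    by apply: rsum_ge0 => *; exact: Rabs_pos.
  apply: norm_le_sqr; first exact: Hpos.
  rewrite sqnormE; elim: axes => [|j l IH] /=; first lra.
  have := Hpos l; have := Rabs_pos (crd x j).
  have -> : Rsqr (crd x j) = Rabs (crd x j) * Rabs (crd x j).
    by rewrite -Rabs_mult Rabs_pos_eq //; nra.
  nra.
Qed.

(** Cauchy-Schwarz against the constant 1. This is where the factor sqrt d of the contraction ratio
    originates. *)
Lemma sum_abs_le_norm x :
  rsum axes (fun j => Rabs (crd x j)) <= sqrt (INR (d.-1).+1) * norm x.
Proof.
  apply: Rsqr_incr_0_var; last by apply: Rmult_le_pos; [exact: sqrt_pos|exact: norm_ge0].
  have := cauchy_schwarz _ axes (fun=> 1) (fun j => Rabs (crd x j)).
  rewrite (rsum_eq _ _ (fun i => 1 * _) (fun j => Rabs (crd x j))); last by move=> *; lra.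
  rewrite rsum_const length_axes Rsqr_1 Rmult_1_r Rsqr_mult Rsqr_sqrt; last exact: pos_INR.
  have -> : Rsqr (norm x) = rsum axes (fun j => Rsqr (crd x j)) by rewrite -sqnormE -norm_sqr.
  rewrite (rsum_eq _ _ (fun i => Rsqr (Rabs _)) (fun j => Rsqr (crd x j))) //.
  by move=> *; rewrite -Rsqr_abs.
Qed.

Lemma norm_triangle x y : norm (vadd x y) <= norm x + norm y.
Proof.
  have Hx := norm_ge0 x; have Hy := norm_ge0 y.
  apply: norm_le_sqr; first lra.
  have CS := cauchy_schwarz _ axes (crd x) (crd y).
  rewrite -!sqnormE -!norm_sqr in CS.
  have : rsum axes (fun i => crd x i * crd y i) <= norm x * norm y.
    apply: Rsqr_incr_0_var; last by nra.
    rewrite /Rsqr in CS *; lra.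
  have -> : sqnorm (vadd x y) =
     sqnorm x + sqnorm y + 2 * rsum axes (fun i => crd x i * crd y i).
    rewrite !sqnormE -rsum_scal -!rsum_plus; apply: rsum_eq => j _.
    rewrite crdE /Rsqr; lra.
  rewrite -!norm_sqr; lra.
Qed.

Lemma norm_scale c x : norm (vscale c x) = Rabs c * norm x.
Proof.
  rewrite /norm -sqrt_Rsqr_abs -sqrt_mult; [|exact: Rle_0_sqr|exact: sqnorm_ge0].
  rewrite !sqnormE -rsum_scal; f_equal; apply: rsum_eq => j _.
  by rewrite crdE Rsqr_mult.
Qed.

Lemma norm_eq0 x : norm x = 0 -> x = vzero.
Proof.
  move=> H; apply: vec_ext => j; have := crd_le_norm x j; rewrite H => Hj.
  have -> : crd x j = 0 by have := Rabs_pos (crd x j); move: Hj; split_Rabs; lra.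
  by case: j {Hj}.
Qed.

Lemma norm0 : norm (@vzero d) = 0.
Proof.
  have -> : (@vzero d) = vscale 0 vzero by apply: vec_ext => j; rewrite crdE; case: j => /= *; lra.
  by rewrite norm_scale Rabs_R0 Rmult_0_l.
Qed.

Definition dst x y : R := Defs.dist x y.

Lemma dst_ge0 x y : 0 <= dst x y.
Proof. exact: norm_ge0. Qed.

Lemma norm_congr x y : (forall j, Rabs (crd x j) = Rabs (crd y j)) -> norm x = norm y.
Proof.
  move=> H; rewrite /norm !sqnormE; f_equal; apply: rsum_eq => j _.
  by rewrite Rsqr_abs H -Rsqr_abs.
Qed.

Lemma dst_congr x y z w :
  (forall j, Rabs (crd x j - crd y j) = Rabs (crd z j - crd w j)) -> dst x y = dst z w.
Proof. by move=> H; apply: norm_congr => j; rewrite !crdE. Qed.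

Lemma dst_sym x y : dst x y = dst y x.
Proof. by apply: dst_congr => j; rewrite Rabs_minus_sym. Qed.

Lemma dst_triangle y x z : dst x z <= dst x y + dst y z.
Proof.
  apply: Rle_trans (norm_triangle _ _); apply: Req_le; apply: norm_congr => j.
  rewrite !crdE; f_equal; lra.
Qed.

Lemma dst_self x : dst x x = 0.
Proof.
  rewrite -norm0; apply: norm_congr => j; rewrite !crdE; f_equal; case: j => /= *; lra.
Qed.

Lemma dst_eq0 x y : dst x y <= 0 -> x = y.
Proof.
  move=> H; have H0 : norm (vsub x y) = 0 by apply: Rle_antisym => //; exact: dst_ge0.
  apply: vec_ext => j; have := f_equal (crd^~ j) (norm_eq0 _ H0); rewrite crdE.
  by case: j => /= *; lra.
Qed.

Lemma dst_scale c x y : dst (vscale c x) (vscale c y) = Rabs c * dst x y.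
Proof.
  rewrite /dst /Defs.dist -norm_scale; apply: norm_congr => j; rewrite !crdE; f_equal; lra.
Qed.

Lemma dst_crd x y j : Rabs (crd x j - crd y j) <= dst x y.
Proof. by rewrite -crd_vsub; apply: crd_le_norm. Qed.

Lemma dst_le_sum_abs x y : dst x y <= rsum axes (fun j => Rabs (crd x j - crd y j)).
Proof.
  apply: Rle_trans (norm_le_sum_abs _) _; apply: Req_le; apply: rsum_eq => j _.
  by rewrite crdE.
Qed.

Lemma dst_vzero x : dst x vzero = norm x.
Proof. by apply: norm_congr => j; rewrite !crdE; f_equal; case: j => /= *; lra. Qed.

Lemma norm_le_dst x y : norm x <= norm y + dst x y.
Proof. rewrite -!dst_vzero; have := dst_triangle y x vzero; lra. Qed.

End Vectors.

(** * The map on a half-beam *)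

Lemma exp_le a b : a <= b -> exp a <= exp b.
Proof. by case=> [H|->]; [left; exact: exp_increasing|exact: Rle_refl]. Qed.

Section HalfBeam.
Context {d : nat}.
Variable F : vec d -> vec d.
Hypothesis HC : F_on_half_cube F.
Hypothesis HB : F_on_half_beam F.

Definition half_beam (x : vec d) : Prop := (forall i, -1 <= fst x i <= 1) /\ 0 <= snd x.
(** A point of the half-beam is split into its projection [cap] to the half-cube and its height
    [excess] above level 1. With these, the bi-Lipschitz part and the exponential part of F obey the
    single formula [F_cap]. *)
Definition cap (x : vec d) : vec d := (fst x, Rmin 1 (snd x)).
Definition excess (x : vec d) : R := Rmax 0 (snd x - 1).

Lemma half_cube_cap x : half_beam x -> in_half_cube (cap x).
Proof. move=> [H1 H2]; split=> //=; rewrite /Rmin; case: Rle_dec => *; lra. Qed.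

Lemma excess_ge0 x : 0 <= excess x.
Proof. exact: Rmax_l. Qed.

Lemma exp_excess_ge1 x : 1 <= exp (excess x).
Proof. have := exp_ineq1_le (excess x); have := excess_ge0 x; lra. Qed.

Lemma F_cap x : half_beam x -> F x = vscale (exp (excess x)) (F (cap x)).
Proof.
  move=> [H1 H2]; rewrite /excess /cap; case: (Rle_dec (snd x) 1) => Hx.
    rewrite Rmax_left ?Rmin_right ?exp_0; try lra.
    by apply: vec_ext => j; rewrite crdE -surjective_pairing; lra.
  rewrite Rmax_right ?Rmin_left; try lra.
  by apply: HB => //; lra.
Qed.

Lemma norm_F_cap x : half_beam x -> norm (F (cap x)) <= 1.
Proof. by case: HC => _ [H _] /half_cube_cap /H []. Qed.

Lemma norm_F_cap_top x : half_beam x -> 0 < excess x -> norm (F (cap x)) = 1.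
Proof.
  case: HC => _ [_ [_ [H _]]] /half_cube_cap /H Hx He; apply: (proj1 (Hx _)).
  rewrite /= Rmin_left //; move: He; rewrite /excess /Rmax; case: Rle_dec; lra.
Qed.

Lemma norm_F x : half_beam x -> norm (F x) <= exp (excess x).
Proof.
  move=> Hx; rewrite F_cap // norm_scale Rabs_pos_eq; last by have := exp_excess_ge1 x; lra.
  by have := norm_F_cap _ Hx; have := exp_excess_ge1 x; nra.
Qed.

Lemma norm_F_top x : half_beam x -> 0 < excess x -> norm (F x) = exp (excess x).
Proof.
  move=> Hx He; rewrite F_cap // norm_scale Rabs_pos_eq; last by have := exp_excess_ge1 x; lra.
  rewrite norm_F_cap_top //; lra.
Qed.

(** Above level 1 the norm of [F x] is the exponential of the excess, which dominates the height.
    Thus preimages of bounded sets are bounded. *)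
Lemma height_le_norm_F x : half_beam x -> snd x <= 1 + norm (F x).
Proof.
  move=> Hx; have := norm_F_top x Hx; have := norm_ge0 (F x).
  rewrite /excess /Rmax; case: Rle_dec => H H0 H1; last lra.
  case: (Req_dec (snd x) 1) => [->|Hn]; first lra.
  rewrite H1; last lra.
  have := exp_ineq1_le (snd x - 1); lra.
Qed.

Lemma F_surj_upper z : 0 <= snd z -> exists x, half_beam x /\ F x = z.
Proof.
  move=> Hz; case: HC => _ [_ [Hball [_ [Hsph _]]]].
  case: (Rle_dec (norm z) 1) => Hn.
    have [x [[H1 H2] H3]] := Hball z (conj Hn Hz).
    by exists x; split=> //; split=> //; case: H2.
  (* Outside the unit ball, z is projected radially to the hemisphere; the preimage of the
     projection is then raised by [ln (norm z)]. *)
  have Hi : 0 < / norm z by apply: Rinv_0_lt_compat; lra.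
  have [x [[Hx _] [Hx1 Hw]]] : exists x, in_half_cube x /\ snd x = 1 /\ F x = vscale (/ norm z) z.
    apply: Hsph; split; last by rewrite /=; nra.
    rewrite norm_scale Rabs_pos_eq; last lra.
    by rewrite Rinv_l //; lra.
  have Hl : 0 < ln (norm z) by rewrite -ln_1; apply: ln_increasing; lra.
  exists (fst x, 1 + ln (norm z)); split; first by split=> //=; lra.
  rewrite HB //=; last lra.
  have -> : (fst x, 1) = x by case: x Hx1 {Hx Hw} => a b /= ->.
  have -> : 1 + ln (norm z) - 1 = ln (norm z) by lra.
  rewrite exp_ln; last lra.
  rewrite Hw; apply: vec_ext => j; rewrite !crdE -Rmult_assoc Rinv_r; lra.
Qed.

Lemma Rabs_exp_ge a b : 0 <= a -> 0 <= b -> Rabs (a - b) <= Rabs (exp a - exp b).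
Proof.
  wlog Hab : a b / a <= b => [W Ha Hb|Ha Hb].
    case: (Rle_dec a b) => H; first exact: W.
    rewrite Rabs_minus_sym (Rabs_minus_sym (exp a)); apply: W => //; lra.
  have H : exp b = exp a * exp (b - a) by rewrite -exp_plus; f_equal; lra.
  have H1 := exp_ineq1_le (b - a); have H2 := exp_ineq1_le a.
  have : b - a <= exp b - exp a by nra.
  by split_Rabs; lra.
Qed.

Lemma Rabs_exp_le a b m : a <= m -> b <= m -> Rabs (exp a - exp b) <= exp m * Rabs (a - b).
Proof.
  wlog Hab : a b / a <= b => [W Ha Hb|Ha Hb].
    case: (Rle_dec a b) => H; first exact: W.
    rewrite Rabs_minus_sym (Rabs_minus_sym a); apply: W => //; lra.
  have H : exp a = exp b * exp (a - b) by rewrite -exp_plus; f_equal; lra.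
  have H1 := exp_ineq1_le (a - b).
  have H2 : exp b <= exp m by exact: exp_le.
  have H3 := exp_pos b.
  have H4 := exp_le _ _ Hab.
  rewrite Rabs_left1; last lra.
  rewrite Rabs_left1; last lra.
  nra.
Qed.

Lemma dst_cap_le x y : dst (cap x) (cap y) <= dst x y.
Proof.
  have mono (u v : vec d) : (forall j, Rabs (crd u j) <= Rabs (crd v j)) -> norm u <= norm v.
    move=> H; apply: norm_le_sqr; first exact: norm_ge0.
    rewrite norm_sqr !sqnormE; apply: rsum_le => j _; exact: Rsqr_le_abs_1.
  apply: mono => -[i|]; rewrite !crdE /=; first lra.
  rewrite /Rmin; do 2 case: Rle_dec => ? ; split_Rabs; lra.
Qed.

Lemma excess_dst_le x y : Rabs (excess x - excess y) <= dst x y.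
Proof.
  apply: Rle_trans (dst_crd x y None).
  rewrite /excess /Rmax /=; do 2 case: Rle_dec => ?; split_Rabs; lra.
Qed.

Lemma dst_le_cap_excess x y : dst x y <= dst (cap x) (cap y) + Rabs (excess x - excess y).
Proof.
  pose e : vec d := (fun=> 0, excess x - excess y).
  have -> : Rabs (excess x - excess y) = norm e.
    rewrite /norm /sqnorm /=.
    have -> : forall l : list 'I_(d.-1), foldr (fun (_ : 'I_(d.-1)) (acc : R) => 0² + acc)
      (excess x - excess y)² l = (excess x - excess y)².
      by elim => [|a l IH] //=; rewrite IH Rsqr_0; lra.
    by rewrite sqrt_Rsqr_abs.
  apply: Rle_trans (norm_triangle _ _); apply: Req_le; apply: norm_congr => -[i|]; rewrite !crdE /=; f_equal; first lra.
  rewrite /excess /Rmax /Rmin; do 4 case: Rle_dec => ?; lra.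
Qed.

(** At the higher of the two points, if its excess is positive, [norm (F x)] equals the exponential,
    while at the other one it is at most the exponential; so the difference is bounded by a
    difference of norms. *)
Lemma exp_excess_dst_le x y : half_beam x -> half_beam y ->
  Rabs (exp (excess x) - exp (excess y)) <= dst (F x) (F y).
Proof.
  wlog Hxy : x y / excess y <= excess x => [W Hx Hy|Hx Hy].
    case: (Rle_dec (excess y) (excess x)) => H; first exact: W.
    rewrite Rabs_minus_sym dst_sym; apply: W => //; lra.
  have [H0|H0] : excess x = 0 \/ 0 < excess x by have := excess_ge0 x; lra.
    have -> : excess y = excess x by have := excess_ge0 y; lra.
    rewrite Rminus_diag Rabs_R0; exact: dst_ge0.
  have H1 := norm_F_top _ Hx H0; have H2 := norm_F _ Hy; have H3 := norm_le_dst (F x) (F y).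
  have H4 := exp_le _ _ Hxy.
  rewrite Rabs_pos_eq; lra.
Qed.

Lemma dst_scale_diff s t (u v : vec d) :
  dst (vscale s u) (vscale t v) <= Rabs s * dst u v + Rabs (s - t) * norm v.
Proof.
  rewrite -dst_scale -norm_scale; apply: Rle_trans (norm_triangle _ _).
  apply: Req_le; apply: norm_congr => j; rewrite !crdE; f_equal; lra.
Qed.

Lemma F_expands_half_beam : exists K, 0 < K /\
  forall x y, half_beam x -> half_beam y -> dst x y <= K * dst (F x) (F y).
Proof.
  case: HC => [[L [HL Hlip]] _]; exists (2 * L + 1); split; first lra.
  move=> x y Hx Hy.
  have H1 := exp_excess_dst_le _ _ Hx Hy.
  have H2 := Rabs_exp_ge _ _ (excess_ge0 x) (excess_ge0 y).
  have [H3 _] := Hlip _ _ (half_cube_cap _ Hx) (half_cube_cap _ Hy).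
  have H4 := dst_le_cap_excess x y.
  (* Scaling both cap images by [exp (excess x)], which is at least 1, does not bring them closer.
     Giving y its own factor instead moves the point by at most the difference of the exponentials,
     hence by at most [dst (F x) (F y)]. *)
  suff H5 : dst (F (cap x)) (F (cap y)) <= 2 * dst (F x) (F y).
    rewrite -/(dst _ _) -/(dst _ _) in H3; nra.
  have Hs := exp_excess_ge1 x.
  have : exp (excess x) * dst (F (cap x)) (F (cap y)) <=
         dst (F x) (F y) + Rabs (exp (excess x) - exp (excess y)) * norm (F (cap y)).
    rewrite -{1}(Rabs_pos_eq (exp (excess x))); last lra.
    rewrite -dst_scale -F_cap // Rabs_minus_sym -norm_scale.
    apply: Rle_trans (norm_triangle _ _); apply: Req_le; apply: norm_congr => j.
    rewrite (F_cap y) // !crdE; f_equal; lra.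
  have := norm_F_cap _ Hy; have := norm_ge0 (F (cap y)).
  have := dst_ge0 (F (cap x)) (F (cap y)); have := Rabs_pos (exp (excess x) - exp (excess y)).
  nra.
Qed.

(** F grows exponentially with the height, whence the restriction to heights below [m]. The bound
    serves to carry null sets over by F. *)
Lemma F_lipschitz_bounded m : exists K, 0 < K /\
  forall x y, half_beam x -> half_beam y -> snd x <= m -> snd y <= m ->
    dst (F x) (F y) <= K * dst x y.
Proof.
  case: HC => [[L [HL Hlip]] _].
  have He : 0 < exp (Rmax 0 (m - 1)) by exact: exp_pos.
  exists (exp (Rmax 0 (m - 1)) * (L + 1)); split; first nra.
  move=> x y Hx Hy Hxm Hym.
  have Hex z : snd z <= m -> excess z <= Rmax 0 (m - 1).
    by move=> Hz; apply: Rle_max_compat_l; lra.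
  have H1 := Rabs_exp_le _ _ _ (Hex _ Hxm) (Hex _ Hym).
  have [_ H2] := Hlip _ _ (half_cube_cap _ Hx) (half_cube_cap _ Hy).
  have H3 := dst_cap_le x y; have H4 := excess_dst_le x y.
  have H5 := exp_le _ _ (Hex _ Hxm).
  rewrite (F_cap x) // (F_cap y) //; apply: Rle_trans (dst_scale_diff _ _ _ _) _.
  have H6 := exp_excess_ge1 x; rewrite (Rabs_pos_eq (exp _)); last lra.
  have H7 := norm_F_cap _ Hy; have H8 := norm_ge0 (F (cap y)).
  rewrite -/(dst _ _) -/(dst _ _) in H2.
  have H9 : dst (F (cap x)) (F (cap y)) <= L * dst x y by nra.
  have H10 := dst_ge0 (F (cap x)) (F (cap y)).
  have H11 := Rabs_pos (exp (excess x) - exp (excess y)).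
  have H12 : Rabs (exp (excess x) - exp (excess y)) * norm (F (cap y)) <=
     exp (Rmax 0 (m - 1)) * dst x y by nra.
  have H13 : exp (excess x) * dst (F (cap x)) (F (cap y)) <= exp (Rmax 0 (m - 1)) * (L * dst x y).
    by apply: Rmult_le_compat; lra.
  lra.
Qed.

Lemma F_inj_half_beam x y : half_beam x -> half_beam y -> F x = F y -> x = y.
Proof.
  case: F_expands_half_beam => K [_ H] Hx Hy E; apply: dst_eq0.
  have := H _ _ Hx Hy; rewrite E dst_self; lra.
Qed.

Lemma half_beam_inverse_exists : exists g : vec d -> vec d,
  forall z, 0 <= snd z -> half_beam (g z) /\ F (g z) = z.
Proof.
  pose P z x := 0 <= snd z -> half_beam x /\ F x = z.
  have HP z : exists x, P z x.
    case: (Rle_dec 0 (snd z)) => Hz; last by exists z => /Hz.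
    by have [x Hx] := F_surj_upper _ Hz; exists x.
  exists (fun z => proj1_sig (constructive_indefinite_description _ (HP z))) => z.
  exact: (proj2_sig (constructive_indefinite_description _ (HP z))).
Qed.

End HalfBeam.

(** * Fubini by interval covers *)

Section IntervalCovers.

(** The supremum of the points reachable from p is itself reachable, and if it were less than q one
    could go further. This principle replaces integration along a segment in what follows. *)
Lemma cousin (Q : R -> R -> Prop) p q : p <= q ->
  (forall t, p <= t <= q -> exists delta, 0 < delta /\ forall s s',
     p <= s <= t -> t <= s' <= q -> t - delta < s -> s' < t + delta -> Q s s') ->
  (forall a b c, a <= b <= c -> Q a b -> Q b c -> Q a c) ->
  Q p q.
Proof.
  move=> Hpq Hloc Hadd.
  pose E t := p <= t <= q /\ Q p t.
  have Ep : E p.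
    split; first lra.
    by have [|dl [Hd H]] := Hloc p; [lra|apply: H; lra].
  have [|c [Hub Hlub]] := completeness E _ (ex_intro _ p Ep).
    by exists q => t [[]].
  have Hc1 : p <= c by apply: Hub.
  have Hc2 : c <= q by apply: Hlub => t [[]].
  have [//|dl [Hdl H]] := Hloc c.
  have [t [[Ht1 Ht2] Ht3]] : exists t, E t /\ c - dl < t.
    apply: NNPP => Hn; have : c <= c - dl; last lra.
    apply: Hlub => t Et; case: (Rle_dec t (c - dl)) => // Hgt.
    by case: Hn; exists t; split=> //; lra.
  have Htc : t <= c by apply: Hub.
  have Hmin : c <= Rmin q (c + dl / 2) <= q by rewrite /Rmin; case: Rle_dec => ?; lra.
  have Hmin' : Rmin q (c + dl / 2) <= c + dl / 2 by exact: Rmin_r.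
  have HQ : Q p (Rmin q (c + dl / 2)).
    apply: (Hadd _ t) => //; first lra.
    by apply: H; lra.
  have : Rmin q (c + dl / 2) <= c by apply: Hub; split=> //; lra.
  move=> Hle; suff <- : Rmin q (c + dl / 2) = q by [].
  by move: Hle; rewrite /Rmin; case: Rle_dec => ?; lra.
Qed.

(** The length of the intersection of [a, b] with [lo, hi]; [inside] is the indicator function of
    the open interval from lo to hi. *)
Definition overlap (lo hi a b : R) : R := Rmax 0 (Rmin b hi - Rmax a lo).
Definition inside (lo hi u : R) : R :=
  if Rlt_dec lo u then (if Rlt_dec u hi then 1 else 0) else 0.

Lemma overlap_ge0 lo hi a b : 0 <= overlap lo hi a b.
Proof. exact: Rmax_l. Qed.

Lemma overlap_le lo hi a b : overlap lo hi a b <= Rmax 0 (hi - lo).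
Proof.
  apply: Rle_max_compat_l; have := Rmin_r b hi; have := Rmax_r a lo; lra.
Qed.

Lemma overlap_additive lo hi a b c : a <= b <= c ->
  overlap lo hi a b + overlap lo hi b c <= overlap lo hi a c.
Proof.
  move=> H; rewrite /overlap.
  have hmax x y : (Rmax x y = x /\ y <= x) \/ (Rmax x y = y /\ x <= y).
    by rewrite /Rmax; case: Rle_dec => ?; lra.
  have hmin x y : (Rmin x y = x /\ x <= y) \/ (Rmin x y = y /\ y <= x).
    by rewrite /Rmin; case: Rle_dec => ?; lra.
  have := hmax a lo; have := hmax b lo; have := hmin b hi; have := hmin c hi.
  move: (Rmax a lo) (Rmax b lo) (Rmin b hi) (Rmin c hi) => x y z w ? ? ? ?.
  rewrite /Rmax; do 3 case: Rle_dec => ?; lra.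
Qed.

Lemma inside_ge0 lo hi u : 0 <= inside lo hi u.
Proof. rewrite /inside; case: Rlt_dec => [?|?]; [case: Rlt_dec => ?|]; rewrite /=; lra. Qed.

Lemma inside_eq1 lo hi u : lo < u < hi -> inside lo hi u = 1.
Proof. rewrite /inside => H; case: Rlt_dec => [?|?]; [case: Rlt_dec => ?|]; rewrite /=; lra. Qed.

Lemma inside_overlap lo hi t dl s s' :
  (lo < t < hi -> lo < t - dl /\ t + dl < hi) ->
  s <= t <= s' -> t - dl < s -> s' < t + dl ->
  (s' - s) * inside lo hi t <= overlap lo hi s s'.
Proof.
  move=> H Hs H1 H2; have := overlap_ge0 lo hi s s'.
  rewrite /inside; case: Rlt_dec => [Ha|_] /=; last lra.
  case: Rlt_dec => [Hb|_] /=; last lra.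
  have [H3 H4] := H (conj Ha Hb) => _.
  rewrite /overlap Rmin_left ?(Rmax_left s); try lra.
  have := Rmax_r 0 (s' - s); lra.
Qed.

Lemma uniform_radius (I : Type) (l : list I) (lo hi : I -> R) t :
  exists dl, 0 < dl /\
    forall i, In i l -> lo i < t < hi i -> lo i < t - dl /\ t + dl < hi i.
Proof.
  elim: l => [|i l [dl [H1 H2]]]; first by exists 1; split; [lra|].
  case: (classic (lo i < t < hi i)) => Hi.
    exists (Rmin dl (Rmin ((t - lo i) / 2) ((hi i - t) / 2))); split.
      by repeat apply: Rmin_glb_lt; lra.
    have Ha := Rmin_l dl (Rmin ((t - lo i) / 2) ((hi i - t) / 2)).
    have Hb := Rmin_r dl (Rmin ((t - lo i) / 2) ((hi i - t) / 2)).
    have Hc := Rmin_l ((t - lo i) / 2) ((hi i - t) / 2).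
    have He := Rmin_r ((t - lo i) / 2) ((hi i - t) / 2).
    move=> k [<-|Hk] Hk'; first lra.
    have := H2 k Hk Hk'; lra.
  by exists dl; split=> // k [<-|/H2].
Qed.

(** A Markov inequality for weighted intervals. If the weighted count exceeded [2 * A / dl] at every
    point of a segment of length [dl], the total weighted length would be at least [2 * A], but it
    is at most [A]. *)
Lemma select_coordinate (I : Type) (L : nat -> list I) (c lo hi : I -> R) p dl A :
  exhaustion _ L -> 0 < dl -> 0 < A -> (forall i, 0 <= c i) ->
  (forall N, rsum (L N) (fun i => c i * Rmax 0 (hi i - lo i)) <= A) ->
  exists u, p <= u <= p + dl /\
    forall N, rsum (L N) (fun i => c i * inside (lo i) (hi i) u) <= 2 * A / dl.
Proof.
  move=> HL Hdl HA Hc Hsum; apply: NNPP => Hn.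
  set K := 2 * A / dl in Hn.
  have HK : K * dl = 2 * A by rewrite /K; field; lra.
  have Hterm i a b : 0 <= c i * overlap (lo i) (hi i) a b.
    by apply: Rmult_le_pos => //; exact: overlap_ge0.
  (* The bound is asked for all larger stages as well, so that adjacent intervals can be joined at a
     common stage. *)
  pose Q a b := exists N, forall M, le N M ->
    K * (b - a) <= rsum (L M) (fun i => c i * overlap (lo i) (hi i) a b).
  have : Q p (p + dl).
    apply: cousin; first lra.
    - move=> t Ht.
      have [N HN] : exists N, K < rsum (L N) (fun i => c i * inside (lo i) (hi i) t).
        apply: NNPP => Hn'; apply: Hn; exists t; split=> // N.
        by apply: Rnot_lt_le => Hlt; apply: Hn'; exists N.
      have [r [Hr1 Hr2]] := uniform_radius _ (L N) lo hi t.
      exists r; split=> // s s' Hs Hs' Hs1 Hs2; exists N => M HM.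
      apply: Rle_trans (rsum_exhaustion _ _ _ _ _ HL HM _); last by move=> i; exact: Hterm.
      apply: (Rle_trans _ ((s' - s) * rsum (L N) (fun i => c i * inside (lo i) (hi i) t))); first nra.
      rewrite -rsum_scal; apply: rsum_le => i Hi.
      have := inside_overlap (lo i) (hi i) t r s s' (Hr2 i Hi).
      have := Hc i; move: (inside _ _ _) (overlap _ _ _ _) => ? ? ? H.
      have {}H := H _ _ _; nra.
    - move=> a b e Habe [N1 H1] [N2 H2]; exists (Nat.max N1 N2) => M HM.
      have {}H1 := H1 M ltac:(lia); have {}H2 := H2 M ltac:(lia).
      apply: Rle_trans (_ : rsum (L M) (fun i => c i * overlap (lo i) (hi i) a b +
        c i * overlap (lo i) (hi i) b e) <= _); first by rewrite rsum_plus; lra.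
      apply: rsum_le => i _; have := overlap_additive (lo i) (hi i) a b e Habe.
      have := Hc i; nra.
  move=> [N /(_ N (Nat.le_refl N))].
  have : rsum (L N) (fun i => c i * overlap (lo i) (hi i) p (p + dl)) <= A.
    apply: Rle_trans (Hsum N); apply: rsum_le => i _.
    apply: Rmult_le_compat_l => //; exact: overlap_le.
  nra.
Qed.

Definition upd {T : eqType} (u : T -> R) (j : T) (t : R) : T -> R :=
  fun i => if i == j then t else u i.

Lemma rprod_eq (T : Type) (l : list T) (f g : T -> R) :
  (forall i, In i l -> f i = g i) -> rprod l f = rprod l g.
Proof.
  elim: l => [|a l IH] H //=; rewrite H ?IH //=; last by left.
  by move=> i Hi; apply: H; right.
Qed.

(* An elementary Fubini theorem: boxes of small total volume meet, on average,
   few of the lines in a given direction. *)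
Lemma select_point (I : Type) (L : nat -> list I) (T : eqType) (l : list T)
    (lo hi : I -> T -> R) (c : I -> R) (v : T -> R) dl A :
  exhaustion _ L -> NoDup l -> 0 < dl -> 0 < A -> (forall i, 0 <= c i) ->
  (forall N, rsum (L N) (fun i => c i * rprod l (fun j => Rmax 0 (hi i j - lo i j))) <= A) ->
  exists u : T -> R,
    (forall j, In j l -> v j <= u j <= v j + dl) /\
    (forall j, ~ In j l -> u j = v j) /\
    forall N, rsum (L N) (fun i => c i * rprod l (fun j => inside (lo i j) (hi i j) (u j)))
      <= A * (2 / dl) ^ length l.
Proof.
  move=> HL Hl Hdl; elim: l Hl c A => [|j l IH] Hl c A HA Hc Hsum.
    exists v; split; [by []|split; [by []|move=> N]]; rewrite /= Rmult_1_r; exact: Hsum.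
  have [Hj Hl'] := proj1 (NoDup_cons_iff _ _) Hl.
  have Hpos i : 0 <= rprod l (fun j => Rmax 0 (hi i j - lo i j)).
    by apply: rprod_ge0 => *; exact: Rmax_l.
  (* Coordinate [j] is chosen with the volume of the remaining sides as part of the weight; the
     induction then continues with the indicator of this choice in the weight and the bound
     [2 * A / dl]. *)
  have [||t [Ht1 Ht2]] := select_coordinate _ L
    (fun i => c i * rprod l (fun j => Rmax 0 (hi i j - lo i j)))
    (fun i => lo i j) (fun i => hi i j) (v j) dl A HL Hdl HA.
  - by move=> i; apply: Rmult_le_pos.
  - move=> N; apply: Rle_trans (Hsum N); apply: rsum_le => i _ /=; lra.
  have [|||u [Hu1 [Hu2 Hu3]]] := IH Hl' (fun i => c i * inside (lo i j) (hi i j) t) (2 * A / dl).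
  - by apply: Rdiv_lt_0_compat; lra.
  - by move=> i; apply: Rmult_le_pos => //; exact: inside_ge0.
  - move=> N; apply: Rle_trans (Ht2 N); apply: rsum_le => i _ /=; lra.
  have Hupd i : In i l -> upd u j t i = u i.
    by move=> Hi; rewrite /upd; case: eqP => // E; rewrite E in Hi.
  exists (upd u j t); split; [|split].
  - move=> i [<-|Hi]; first by rewrite /upd eqxx.
    by rewrite Hupd //; exact: Hu1.
  - move=> i Hi; rewrite /upd; case: eqP => [E|_]; first by case: Hi; left.
    by apply: Hu2 => Hi'; apply: Hi; right.
  - move=> N; apply: Rle_trans (_ : 2 * A / dl * (2 / dl) ^ length l <= _); last first.
      by rewrite /=; right; field; lra.
    apply: Rle_trans (Hu3 N); right; apply: rsum_eq => i _ /=.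
    rewrite {1}/upd eqxx (rprod_eq _ _ _ (fun j => inside (lo i j) (hi i j) (u j))); last first.
      by move=> k Hk; rewrite Hupd.
    lra.
Qed.

Lemma grid_cover a b dl : 0 < dl -> a <= b -> exists m, INR m * dl <= b - a + dl /\
  forall x, a <= x <= b -> exists k, lt k m /\ a + INR k * dl <= x <= a + INR k * dl + dl.
Proof.
  move=> Hdl Hab.
  have Hq : 0 <= (b - a) / dl by apply: Rmult_le_pos; [lra|left; exact: Rinv_0_lt_compat].
  have [H1 H2] := archimed ((b - a) / dl).
  have Hup : (0 <= up ((b - a) / dl))%Z by apply: le_IZR; lra.
  exists (Z.to_nat (up ((b - a) / dl))); rewrite INR_IZR_INZ Z2Nat.id //; split.
    have : IZR (up ((b - a) / dl)) * dl <= ((b - a) / dl + 1) * dl by apply: Rmult_le_compat_r; lra.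
    have -> : ((b - a) / dl + 1) * dl = b - a + dl by field; lra.
    by [].
  move=> x Hx.
  have Hm : b <= a + INR (Z.to_nat (up ((b - a) / dl))) * dl.
    rewrite INR_IZR_INZ Z2Nat.id //.
    have : (b - a) / dl * dl <= IZR (up ((b - a) / dl)) * dl by apply: Rmult_le_compat_r; lra.
    have -> : (b - a) / dl * dl = b - a by field; lra.
    lra.
  move: Hm.
  (* [up] strictly exceeds its argument, so there is at least one cell even when a = b. *)
  have Hpos : lt 0 (Z.to_nat (up ((b - a) / dl))).
    have : (0 < up ((b - a) / dl))%Z by apply: lt_IZR; lra.
    lia.
  move: (Z.to_nat _) Hpos => m Hpos Hm; have {Hm Hx} Hx : a <= x <= a + INR m * dl by lra.
  elim: m Hpos Hx => [|m IH] Hpos; first lia.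
  rewrite S_INR => Hx; case: (Rle_dec x (a + INR m * dl)) => Hxm.
    case: m IH Hpos Hx Hxm => [|m] IH _ Hx Hxm.
      by exists 0%nat; split; [lia|rewrite /= in Hxm *; lra].
    have [|//|k [Hk Hkx]] := IH _ _; first lia; first lra.
    by exists k; split; [lia|].
  by exists m; split; [lia|lra].
Qed.

(** A product of one-dimensional grids. Boxes are cut into cubes because a Lipschitz bound controls
    the image only through the diameter, which says little about the volume of a long thin box. *)
Lemma cube_cover (T : eqType) (l : list T) (a b : T -> R) dl :
  NoDup l -> 0 < dl -> (forall i, In i l -> a i <= b i) ->
  exists vs : list (T -> R),
    INR (length vs) * dl ^ length l <= rprod l (fun i => b i - a i + dl) /\
    forall x : T -> R, (forall i, In i l -> a i <= x i <= b i) ->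
      exists v, In v vs /\ forall i, In i l -> v i <= x i <= v i + dl.
Proof.
  elim: l => [|j l IH] Hl Hdl Hab.
    exists [:: a]; split; first by rewrite /=; lra.
    by move=> x _; exists a; split; [left|].
  have [Hj Hl'] := proj1 (NoDup_cons_iff _ _) Hl.
  have [|vs [Hvs1 Hvs2]] := IH Hl' Hdl; first by move=> i Hi; apply: Hab; right.
  have [m [Hm1 Hm2]] := grid_cover (a j) (b j) dl Hdl (Hab j (or_introl erefl)).
  exists (List.map (fun kv => upd kv.2 j (a j + INR kv.1 * dl)) (list_prod (List.seq 0 m) vs)).
  split.
    rewrite length_map length_prod length_seq mult_INR /=.
    have := pos_INR (length vs); have := pow_lt dl (length l) Hdl; have := pos_INR m.
    move=> P1 P2 P3.
    have -> : INR m * INR (length vs) * (dl * dl ^ length l) =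
      (INR m * dl) * (INR (length vs) * dl ^ length l) by ring.
    by apply: Rmult_le_compat => //; nra.
  move=> x Hx.
  have [k [Hk1 Hk2]] := Hm2 (x j) (Hx j (or_introl erefl)).
  have [|v [Hv1 Hv2]] := Hvs2 x; first by move=> i Hi; apply: Hx; right.
  exists (upd v j (a j + INR k * dl)); split.
    apply/in_map_iff; exists (k, v); split=> //.
    by apply: in_prod => //; apply/in_seq; lia.
  move=> i; rewrite /upd; case: eqP => [-> _|Hij [E|Hi]]; [exact: Hk2| by case: Hij|exact: Hv2].
Qed.

(** Makes the volume by which a grid of mesh [dl] overshoots a box of order [dl]. *)
Lemma rprod_perturb (T : Type) (l : list T) (s : T -> R) :
  (forall i, In i l -> 0 <= s i) -> exists C, 0 <= C /\
  forall dl, 0 <= dl <= 1 -> rprod l (fun i => s i + dl) <= rprod l s + C * dl.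
Proof.
  elim: l => [|j l IH] Hs /=; first by exists 0; split=> [|dl _]; lra.
  have [|C [HC1 HC2]] := IH _; first by move=> i Hi; apply: Hs; right.
  have Hj := Hs j (or_introl erefl).
  have HP : 0 <= rprod l s by apply: rprod_ge0 => i Hi; apply: Hs; right.
  exists (rprod l s + (s j + 1) * C); split; first nra.
  move=> dl Hdl; have {}HC2 := HC2 dl Hdl.
  apply: Rle_trans (_ : (s j + dl) * (rprod l s + C * dl) <= _).
    by apply: Rmult_le_compat_l => //; lra.
  have : C * dl * dl <= C * dl by rewrite -{2}(Rmult_1_r (C * dl)); apply: Rmult_le_compat_l; nra.
  nra.
Qed.

End IntervalCovers.

(** * Null sets and Lipschitz maps *)

Section NullImage.
Context {d : nat}.
Variables (f : vec d -> vec d) (D : vec d -> Prop) (K : R).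
Hypothesis HK : 0 <= K.
Hypothesis Hf : forall x y, D x -> D y -> dst (f x) (f y) <= K * dst x y.

(** Open boxes leave room on both sides of a covered point, as the local condition of [cousin]
    requires. *)
Definition in_open_box (b : vec d * vec d) (x : vec d) : Prop :=
  forall j, crd b.1 j < crd x j < crd b.2 j.

Let n := length (@axes d).
Let C := (2 * (K * INR n + 1)) ^ n.

Lemma image_factor_gt0 : 0 < K * INR n + 1.
Proof. have := Rmult_le_pos _ _ HK (pos_INR n); lra. Qed.

Lemma box_vol_ge0 (a b : vec d) : 0 <= box_vol a b.
Proof. by rewrite box_volE; apply: rprod_ge0 => *; exact: Rmax_l. Qed.

Lemma cube_image (v : option 'I_(d.-1) -> R) dl : 0 < dl ->
  exists b : vec d * vec d, box_vol b.1 b.2 <= C * dl ^ n /\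
    forall x, D x -> (forall j, v j <= crd x j <= v j + dl) -> in_open_box b (f x).
Proof.
  (* Points of the cube are at distance at most [INR n * dl] from each other; the additional 1 makes
     the inequality strict, so that the image box is open. *)
  move=> Hdl; set r := (K * INR n + 1) * dl.
  have Hr : 0 < r by apply: Rmult_lt_0_compat => //; exact: image_factor_gt0.
  have Hvol (c : vec d) :
      box_vol (vec_of (fun j => crd c j - r)) (vec_of (fun j => crd c j + r)) <= C * dl ^ n.
    rewrite box_volE (rprod_eq _ _ _ (fun=> 2 * r)).
      by rewrite rprod_const -/n /C /r -Rpow_mult_distr; right; f_equal; ring.
    by move=> j _; rewrite !crdE Rmax_right; lra.
  case: (classic (exists x, D x /\ forall j, v j <= crd x j <= v j + dl)) => [[c [Hc1 Hc2]]|Hn].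
    exists (vec_of (fun j => crd (f c) j - r), vec_of (fun j => crd (f c) j + r)).
    split=> //= x Hx1 Hx2 j; rewrite /= !crdE.
    have H1 := dst_crd (f x) (f c) j; have H2 := Hf _ _ Hx1 Hc1.
    have H3 : dst x c <= INR n * dl.
      apply: Rle_trans (dst_le_sum_abs _ _) _; rewrite -rsum_const; apply: rsum_le => k _.
      have := Hx2 k; have := Hc2 k; split_Rabs; lra.
    have H4 : dst (f x) (f c) < r.
      apply: (Rle_lt_trans _ (K * (INR n * dl))); last by rewrite /r; nra.
      by apply: Rle_trans H2 _; apply: Rmult_le_compat_l.
    move: (Rle_lt_trans _ _ _ H1 H4); split_Rabs; lra.
  (* A cube that misses [D] imposes no condition, and any box of the right volume will do. *)
  exists (vec_of (fun j => crd vzero j - r), vec_of (fun j => crd vzero j + r)).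
  by split=> //= x Hx1 Hx2; case: Hn; exists x.
Qed.

(** The slack [eta] pays for the overshoot of the grid, which is positive even for a box of volume
    zero. *)
Lemma box_image (a b : vec d) eta : 0 < eta ->
  exists l : list (vec d * vec d),
    rsum l (fun i => box_vol i.1 i.2) <= C * (box_vol a b + eta) /\
    forall x, D x -> in_box a b x -> exists i, In i l /\ in_open_box i (f x).
Proof.
  move=> Heta.
  have HC : 0 < C by apply: pow_lt; have := image_factor_gt0; lra.
  case: (classic (forall j, crd a j <= crd b j)) => [Hab|Hab]; last first.
    exists nil; split; first by rewrite /=; have := box_vol_ge0 a b; nra.
    move=> x _ /in_boxE Hx; case: Hab => j; have := Hx j; lra.
  have [|C1 [HC1 HC2]] := rprod_perturb _ axes (fun j => crd b j - crd a j).
    by move=> j _; have := Hab j; lra.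
  pose dl := Rmin 1 (eta / (C1 + 1)).
  have Hdl : 0 < dl.
    by apply: Rmin_glb_lt; [lra|apply: Rdiv_lt_0_compat; lra].
  have Hdl1 : dl <= 1 by exact: Rmin_l.
  have Hdl2 : C1 * dl <= eta.
    have : (C1 + 1) * dl <= (C1 + 1) * (eta / (C1 + 1)) by apply: Rmult_le_compat_l; [lra|exact: Rmin_r].
    have -> : (C1 + 1) * (eta / (C1 + 1)) = eta by field; lra.
    lra.
  have [|vs [Hvs1 Hvs2]] := cube_cover _ axes (crd a) (crd b) dl NoDup_axes Hdl; first by move=> j _.
  have Himg := fun v => cube_image v dl Hdl.
  pose img v := proj1_sig (constructive_indefinite_description _ (Himg v)).
  have Himgv v := proj2_sig (constructive_indefinite_description _ (Himg v)).
  exists (List.map img vs); split.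
    apply: (Rle_trans _ (INR (length vs) * (C * dl ^ n))).
      have -> : INR (length vs) = INR (length (List.map img vs)) by rewrite length_map.
      rewrite -rsum_const; apply: rsum_le => i /in_map_iff [v [<- _]].
      exact: (proj1 (Himgv v)).
    have -> : INR (length vs) * (C * dl ^ n) = C * (INR (length vs) * dl ^ n) by ring.
    apply: Rmult_le_compat_l; first lra.
    apply: Rle_trans Hvs1 _; apply: Rle_trans (HC2 dl _) _; first lra.
    rewrite box_volE (rprod_eq _ axes (fun j => Rmax _ _) (fun j => crd b j - crd a j)); first lra.
    by move=> j _; rewrite Rmax_right //; have := Hab j; lra.
  move=> x Hx /in_boxE Hxb.
  have [|v [Hv1 Hv2]] := Hvs2 (crd x); first by move=> j _.
  exists (img v); split; first exact: List.in_map.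
  by apply: (proj2 (Himgv v)) => // j; apply: Hv2; exact: in_axes.
Qed.

Lemma null_image (E : vec d -> Prop) eps : null_set E -> 0 < eps ->
  exists L : nat -> list (vec d * vec d), exhaustion _ L /\
    (forall N, rsum (L N) (fun i => box_vol i.1 i.2) <= eps) /\
    forall x, E x -> D x -> exists N i, In i (L N) /\ in_open_box i (f x).
Proof.
  move=> HE Heps.
  have HC : 0 < C by apply: pow_lt; have := image_factor_gt0; lra.
  have Hq : 0 < eps / (2 * C) by apply: Rdiv_lt_0_compat; lra.
  have [a [b [Hcov Hsum]]] := HE _ Hq.
  (* After multiplication by [C], half of [eps] goes to the volumes of the given boxes and half to
     the slacks, which form a geometric series. *)
  have Hbox k := box_image (a k) (b k) (eps / (2 * C) * (1 / 2) ^ Datatypes.S k)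
    (Rmult_lt_0_compat _ _ Hq (pow_lt (1 / 2) _ ltac:(lra))).
  pose l k := proj1_sig (constructive_indefinite_description _ (Hbox k)).
  have Hl k := proj2_sig (constructive_indefinite_description _ (Hbox k)).
  exists (fun N => concat (List.map l (List.seq 0 N))); split; first exact: exhaustion_concat.
  split.
    have Hpart N : rsum (concat (List.map l (List.seq 0 (Datatypes.S N)))) (fun i => box_vol i.1 i.2) <=
      C * (sum_f_R0 (fun k => box_vol (a k) (b k)) N + eps / (2 * C) * (1 - (1 / 2) ^ Datatypes.S N)).
      elim: N => [|N IH]; rewrite concat_seq_S rsum_cat.
        apply: Rle_trans (Rplus_le_compat_l _ _ _ (proj1 (Hl _))) _.
        rewrite /=; right; field; lra.
      apply: Rle_trans (Rplus_le_compat _ _ _ _ IH (proj1 (Hl _))) _.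
      by rewrite /=; right; field; lra.
    case=> [|N]; first by rewrite /=; lra.
    apply: Rle_trans (Hpart N) _.
    have -> : eps = C * (eps / (2 * C) + eps / (2 * C)) by field; lra.
    apply: Rmult_le_compat_l; first lra.
    apply: Rplus_le_compat; first by have := Hsum N; lra.
    have -> : C * (eps / (2 * C) + eps / (2 * C)) = eps by field; lra.
    have := pow_lt (1 / 2) (Datatypes.S N) ltac:(lra); nra.
  move=> x Ex Dx; have [k Hk] := Hcov x Ex.
  have [i [Hi1 Hi2]] := proj2 (Hl k) x Dx Hk.
  exists (Datatypes.S k), i; split=> //.
  by rewrite concat_seq_S; apply: in_or_app; right.
Qed.

End NullImage.

(** * From almost everywhere local dilation bounds to a global bound in the l^1 norm *)

Section AxisLipschitz.
Context {d : nat}.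
Variables (g : vec d -> vec d) (K M : R).
Hypothesis HK : 0 <= K.
Hypothesis HM : 0 <= M.
Hypothesis Hg : forall z w, 0 <= snd z -> 0 <= snd w -> dst (g z) (g w) <= K * dst z w.

Definition locally_dilates_le (z : vec d) : Prop :=
  exists dl, 0 < dl /\ forall w, 0 <= snd w -> dst w z < dl -> dst (g w) (g z) <= M * dst w z.

Hypothesis Hnull : forall r eps, 0 < eps ->
  exists L : nat -> list (vec d * vec d), exhaustion _ L /\
    (forall N, rsum (L N) (fun i => box_vol i.1 i.2) <= eps) /\
    forall z, 0 <= snd z -> norm z <= r -> ~ locally_dilates_le z ->
      exists N i, In i (L N) /\ in_open_box i z.

Definition set_crd (z : vec d) j t : vec d := vec_of (upd (crd z) j t).

Lemma crd_set_crd z j t i : crd (set_crd z j t) i = if i == j then t else crd z i.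
Proof. by rewrite crdE. Qed.

Lemma dst_set_crd z j s t : dst (set_crd z j s) (set_crd z j t) = Rabs (s - t).
Proof.
  apply: Rle_antisym; last first.
    by have := dst_crd (set_crd z j s) (set_crd z j t) j; rewrite !crd_set_crd eqxx.
  apply: Rle_trans (dst_le_sum_abs _ _) _.
  have [l1 [l2 E]] := in_split j axes (in_axes j).
  have HND := @NoDup_axes d; rewrite E in HND.
  have Hj := NoDup_remove_2 _ _ _ HND.
  have H0 l : ~ In j l -> rsum l (fun i => Rabs (crd (set_crd z j s) i - crd (set_crd z j t) i)) = 0.
    move=> Hl; rewrite (rsum_eq _ _ _ (fun=> 0)) ?rsum_const ?Rmult_0_r // => i Hi.
    rewrite !crd_set_crd; case: eqP => [Ei|_]; first by rewrite Ei in Hi.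
    by rewrite Rminus_diag Rabs_R0.
  rewrite E rsum_cat /= !H0 ?crd_set_crd ?eqxx; first lra.
  - by move=> Hi; apply: Hj; apply: in_or_app; right.
  - by move=> Hi; apply: Hj; apply: in_or_app; left.
Qed.

Lemma snd_set_crd_ge0 z j s : 0 <= snd z -> (j = None -> 0 <= s) -> 0 <= snd (set_crd z j s).
Proof.
  move=> Hz Hj; rewrite -[snd _]/(crd (set_crd z j s) None) crd_set_crd.
  by case: eqP => [E|_] //; apply: Hj.
Qed.

(** Around a good point of the segment the local bound [M] applies. Around a bad point the crude
    constant [K] is used, and the length is charged to a covering box containing a whole
    neighbourhood of the point in the line. [cousin] glues the estimates. *)
Lemma dilation_along_line (L : nat -> list (vec d * vec d)) z j p q :
  exhaustion _ L -> p <= q -> 0 <= snd z -> (j = None -> 0 <= p) ->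
  (forall t, p <= t <= q -> ~ locally_dilates_le (set_crd z j t) ->
     exists N i, In i (L N) /\ in_open_box i (set_crd z j t)) ->
  forall l1 l2, axes = (l1 ++ j :: l2)%list ->
  exists N, dst (g (set_crd z j p)) (g (set_crd z j q)) <= M * (q - p) +
    K * rsum (L N) (fun i => Rmax 0 (crd i.2 j - crd i.1 j) *
          rprod (l1 ++ l2)%list (fun k => inside (crd i.1 k) (crd i.2 k) (crd z k))).
Proof.
  move=> HL Hpq Hz Hp Hbad l1 l2 El.
  have HND := @NoDup_axes d; rewrite El in HND.
  have Hj := NoDup_remove_2 _ _ _ HND.
  pose w (i : vec d * vec d) :=
    rprod (l1 ++ l2)%list (fun k => inside (crd i.1 k) (crd i.2 k) (crd z k)).
  have Hw i : 0 <= w i by apply: rprod_ge0 => *; exact: inside_ge0.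
  pose ov a b (i : vec d * vec d) := overlap (crd i.1 j) (crd i.2 j) a b * w i.
  have Hov a b i : 0 <= ov a b i by apply: Rmult_le_pos => //; exact: overlap_ge0.
  have Hup t : p <= t -> 0 <= snd (set_crd z j t).
    by move=> Ht; apply: snd_set_crd_ge0 => // /Hp; lra.
  pose Q a b := exists N, forall m, le N m ->
    dst (g (set_crd z j a)) (g (set_crd z j b)) <= M * (b - a) + K * rsum (L m) (ov a b).
  have : Q p q.
    apply: cousin => //.
    - move=> t Ht; case: (classic (locally_dilates_le (set_crd z j t))) => Hgood.
        have [dl [Hdl H]] := Hgood; exists dl; split=> // s s' Hs Hs' Hs1 Hs2.
        exists 0%nat => m _.
        have H1 := H (set_crd z j s) (Hup s ltac:(lra)).
        have H2 := H (set_crd z j s') (Hup s' ltac:(lra)).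
        rewrite !dst_set_crd in H1 H2.
        have {}H1 := H1 ltac:(split_Rabs; lra); have {}H2 := H2 ltac:(split_Rabs; lra).
        rewrite (Rabs_left1 (s - t)) in H1; last lra.
        rewrite (Rabs_pos_eq (s' - t)) in H2; last lra.
        have := dst_triangle (g (set_crd z j t)) (g (set_crd z j s)) (g (set_crd z j s')).
        rewrite (dst_sym (g (set_crd z j t))).
        have : 0 <= rsum (L m) (ov s s') by apply: rsum_ge0.
        nra.
      have [N [i [Hi1 Hi2]]] := Hbad t Ht Hgood.
      have Hij := Hi2 j; rewrite crd_set_crd eqxx in Hij.
      have Hwi : w i = 1.
        rewrite /w (rprod_eq _ _ _ (fun=> 1)) ?rprod_const ?pow1 // => k Hk.
        apply: inside_eq1; have := Hi2 k; rewrite crd_set_crd.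
        by case: eqP => [Ek|//]; rewrite Ek in Hk.
      exists (Rmin (t - crd i.1 j) (crd i.2 j - t)); split; first by apply: Rmin_glb_lt; lra.
      have R1 := Rmin_l (t - crd i.1 j) (crd i.2 j - t).
      have R2 := Rmin_r (t - crd i.1 j) (crd i.2 j - t).
      move=> s s' Hs Hs' Hs1 Hs2; exists N => m Hm.
      have H1 := Hg (set_crd z j s) (set_crd z j s') (Hup s ltac:(lra)) (Hup s' ltac:(lra)).
      rewrite dst_set_crd in H1.
      have H2 : s' - s <= rsum (L m) (ov s s').
        apply: Rle_trans (rsum_exhaustion _ _ _ _ _ HL Hm (Hov s s')).
        apply: Rle_trans (rsum_ge_term _ _ (ov s s') _ (fun i _ => Hov s s' i) Hi1).
        rewrite /ov Hwi /overlap Rmin_left ?(Rmax_left s) ?Rmax_right; lra.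
      rewrite (Rabs_left1 (s - s')) in H1; last lra.
      have : K * (s' - s) <= K * rsum (L m) (ov s s') by apply: Rmult_le_compat_l.
      nra.
    - move=> a b c Habc [N1 H1] [N2 H2]; exists (Nat.max N1 N2) => m Hm.
      have {}H1 := H1 m ltac:(lia); have {}H2 := H2 m ltac:(lia).
      have := dst_triangle (g (set_crd z j b)) (g (set_crd z j a)) (g (set_crd z j c)).
      have H3 : rsum (L m) (ov a b) + rsum (L m) (ov b c) <= rsum (L m) (ov a c).
        rewrite -rsum_plus; apply: rsum_le => i _.
        have := overlap_additive (crd i.1 j) (crd i.2 j) a b c Habc; have := Hw i.
        by rewrite /ov; nra.
      have : K * (rsum (L m) (ov a b) + rsum (L m) (ov b c)) <= K * rsum (L m) (ov a c).
        exact: Rmult_le_compat_l.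
      lra.
  move=> [N /(_ N (Nat.le_refl N)) H]; exists N; apply: Rle_trans H _.
  apply: Rplus_le_compat_l; apply: Rmult_le_compat_l => //; apply: rsum_le => i _.
  apply: Rmult_le_compat_r; [exact: Hw|exact: overlap_le].
Qed.

(** The given segment may lie inside the exceptional set. It is therefore replaced by a nearby
    parallel one that meets the covering boxes in small total length; the crude constant [K] bounds
    the cost of moving the endpoints. *)
Lemma lipschitz_along_axis z j p q : p <= q -> 0 <= snd z -> (j = None -> 0 <= p) ->
  dst (g (set_crd z j p)) (g (set_crd z j q)) <= M * (q - p).
Proof.
  move=> Hpq Hz Hp; apply: le_epsilon => eps Heps.
  have [l1 [l2 El]] := in_split j axes (in_axes j).
  have HND := @NoDup_axes d; rewrite El in HND.
  have Hj := NoDup_remove_2 _ _ _ HND; have {}HND := NoDup_remove_1 _ _ _ HND.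
  pose n := INR (length (@axes d)).
  have Hn : 0 <= n by exact: pos_INR.
  have HnK : 0 <= n * K by apply: Rmult_le_pos.
  (* A shift by at most [dl] in each coordinate moves the image of an endpoint by at most
     [eps / 4]. *)
  pose dl := Rmin 1 (eps / (4 * (n * K + 1))).
  have Hdl : 0 < dl by apply: Rmin_glb_lt; [lra|apply: Rdiv_lt_0_compat; lra].
  have Hdl2 : K * (n * dl) <= eps / 4.
    have : dl <= eps / (4 * (n * K + 1)) by exact: Rmin_r.
    move/(Rmult_le_compat_l (n * K + 1) _ _ ltac:(lra)).
    have -> : (n * K + 1) * (eps / (4 * (n * K + 1))) = eps / 4 by field; lra.
    lra.
  have HT : 0 < (2 / dl) ^ length (l1 ++ l2)%list.
    by apply: pow_lt; apply: Rdiv_lt_0_compat; lra.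
  set T := _ ^ _ in HT.
  (* [T] is the loss factor of [select_point] for this [dl]. The covering volume is fixed only
     afterwards, so that the boxes contribute at most [eps / 2]. *)
  pose A := eps / (2 * (K + 1) * T).
  have HA : 0 < A by apply: Rdiv_lt_0_compat => //; nra.
  have HAT : K * (A * T) <= eps / 2.
    have : (K + 1) * (A * T) = eps / 2 by rewrite /A; field; lra.
    have : 0 < A * T by nra.
    lra.
  pose z1 := set_crd z j p.
  pose r := norm z1 + n * dl + (q - p).
  have [L [HL [Hvol Hcov]]] := Hnull r A HA.
  have [||u [Hu1 [Hu2 Hu3]]] := select_point _ L _ (l1 ++ l2)%list
    (fun i => crd i.1) (fun i => crd i.2) (fun i => Rmax 0 (crd i.2 j - crd i.1 j))
    (crd z) dl A HL HND Hdl HA.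
  - by move=> i; exact: Rmax_l.
  - move=> N; apply: Rle_trans (Hvol N); apply: rsum_le => i _.
    by rewrite box_volE El rprod_split; right.
  pose zu : vec d := vec_of u.
  (* Coordinates are only increased, so the shifted segment stays in the upper half-space. *)
  have Hclose k : 0 <= crd zu k - crd z k <= dl.
    rewrite /zu crdE; case: (classic (In k (l1 ++ l2)%list)) => Hk.
      by have := Hu1 _ Hk; lra.
    by rewrite Hu2 //; lra.
  have Hzu : 0 <= snd zu by have := Hclose None; rewrite /=; lra.
  have Hdist t : dst (set_crd zu j t) (set_crd z j t) <= n * dl.
    apply: Rle_trans (dst_le_sum_abs _ _) _; rewrite /n -rsum_const; apply: rsum_le => k _.
    rewrite !crd_set_crd; case: eqP => _; first by rewrite Rminus_diag Rabs_R0; lra.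
    by have := Hclose k; split_Rabs; lra.
  have Hup t w : 0 <= snd w -> p <= t -> 0 <= snd (set_crd w j t).
    by move=> Hw Ht; apply: snd_set_crd_ge0 => // /Hp; lra.
  have [|N HN] := dilation_along_line L zu j p q HL Hpq Hzu Hp _ l1 l2 El.
    move=> t Ht; apply: Hcov; first by apply: Hup; lra.
    have := norm_le_dst (set_crd zu j t) (set_crd z j t); have := Hdist t.
    have := norm_le_dst (set_crd z j t) z1; rewrite /r /z1 dst_set_crd Rabs_pos_eq; last lra.
    lra.
  have H3 : K * rsum (L N) (fun i => Rmax 0 (crd i.2 j - crd i.1 j) *
    rprod (l1 ++ l2)%list (fun k => inside (crd i.1 k) (crd i.2 k) (crd zu k))) <= eps / 2.
    apply: Rle_trans HAT; apply: Rmult_le_compat_l => //; apply: Rle_trans (Hu3 N); right.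
    by apply: rsum_eq => i _; f_equal; apply: rprod_eq => k _; rewrite /zu crdE.
  have Hnear t : p <= t -> dst (g (set_crd zu j t)) (g (set_crd z j t)) <= eps / 4.
    move=> Ht; apply: Rle_trans (Hg _ _ (Hup _ _ Hzu Ht) (Hup _ _ Hz Ht)) _.
    by apply: Rle_trans Hdl2; apply: Rmult_le_compat_l.
  have H1 := Hnear p ltac:(lra); have H2 := Hnear q Hpq.
  have := dst_triangle (g (set_crd zu j p)) (g (set_crd z j p)) (g (set_crd z j q)).
  have := dst_triangle (g (set_crd zu j q)) (g (set_crd zu j p)) (g (set_crd z j q)).
  rewrite (dst_sym (g (set_crd z j p)) (g (set_crd zu j p))); lra.
Qed.

(** Coordinates of z are replaced by those of w one at a time; the intermediate points remain in the
    upper half-space. *)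
Lemma lipschitz_l1 z w : 0 <= snd z -> 0 <= snd w ->
  dst (g z) (g w) <= M * rsum axes (fun j => Rabs (crd z j - crd w j)).
Proof.
  move=> Hz Hw.
  have Hstep u j t : 0 <= snd u -> (j = None -> 0 <= t) ->
      dst (g u) (g (set_crd u j t)) <= M * Rabs (crd u j - t).
    move=> Hu Ht.
    have E : u = set_crd u j (crd u j).
      by apply: vec_ext => k; rewrite crd_set_crd; case: eqP => [->|].
    have Huj : j = None -> 0 <= crd u j by move=> ->.
    rewrite {1}E; case: (Rle_dec (crd u j) t) => H.
      rewrite Rabs_left1; last lra.
      by have := lipschitz_along_axis u j _ _ H Hu Huj; lra.
    rewrite Rabs_pos_eq; last lra.
    by rewrite dst_sym; apply: lipschitz_along_axis => //; lra.
  have : forall l u, NoDup l -> 0 <= snd u -> (forall j, In j l -> crd u j = crd z j) ->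
     (forall j, ~ In j l -> crd u j = crd w j) ->
     dst (g u) (g w) <= M * rsum l (fun j => Rabs (crd z j - crd w j)).
    elim=> [|j l IH] u Hl Hu H1 H2.
      have -> : u = w by apply: vec_ext => j; apply: H2.
      by rewrite dst_self /=; lra.
    have [Hj Hl'] := proj1 (NoDup_cons_iff _ _) Hl.
    have Hwj : j = None -> 0 <= crd w j by move=> ->.
    have H3 := Hstep u j (crd w j) Hu Hwj; rewrite (H1 j (or_introl erefl)) in H3.
    have H4 := dst_triangle (g (set_crd u j (crd w j))) (g u) (g w).
    have H5 : dst (g (set_crd u j (crd w j))) (g w) <= M * rsum l (fun j => Rabs (crd z j - crd w j)).
      apply: IH => //.
      - exact: snd_set_crd_ge0.
      - move=> k Hk; rewrite crd_set_crd; case: eqP => [E|_]; first by rewrite E in Hk.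
        by apply: H1; right.
      - move=> k Hk; rewrite crd_set_crd; case: eqP => [-> //|E].
        by apply: H2 => -[E'|//]; apply: E.
    rewrite /=; lra.
  apply=> //; first exact: NoDup_axes.
  by move=> j Hj; case: Hj; exact: in_axes.
Qed.

End AxisLipschitz.

(** * Inverse branches and density *)

Section InverseLipschitz.
Context {d : nat}.
Variable F : vec d -> vec d.
Hypothesis HC : F_on_half_cube F.
Hypothesis HB : F_on_half_beam F.
Variable g : vec d -> vec d.
Hypothesis Hg : forall z, 0 <= snd z -> half_beam (g z) /\ F (g z) = z.
Variable beta : R.
Hypothesis Hbeta : 0 < beta.

Lemma ell_ge_norm (A : vec d -> vec d) c h : is_linear A -> ell_ge A c -> c * norm h <= norm (A h).
Proof.
  move=> [_ Hs] Hell; have [H0|H0] : norm h = 0 \/ 0 < norm h by have := norm_ge0 h; lra.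
    rewrite H0 Rmult_0_r; exact: norm_ge0.
  have Hi := Rinv_0_lt_compat _ H0.
  have := Hell (vscale (/ norm h) h); rewrite Hs !norm_scale Rabs_pos_eq; last lra.
  rewrite Rinv_l; last lra.
  move=> /(_ erefl) /(Rmult_le_compat_l _ _ _ (Rlt_le _ _ H0)).
  rewrite -Rmult_assoc Rinv_r; lra.
Qed.

Lemma inverse_dilates_le M z : / beta < M -> 0 <= snd z ->
  (exists A, diff_at F (g z) A /\ ell_ge A beta) -> locally_dilates_le g M z.
Proof.
  move=> HM Hz [A [[Hlin Hdiff] Hell]].
  have HM0 : 0 < M by have := Rinv_0_lt_compat _ Hbeta; lra.
  (* With the tolerance [beta - / M] in the differentiability of F, displacements near [g z] are
     stretched at least by [/ M]. The crude Lipschitz bound on g ensures that the displacements are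
     small enough. *)
  have Heta : 0 < beta - / M.
    have : / M < / / beta by apply: Rinv_lt_contravar => //; apply: Rmult_lt_0_compat => //; exact: Rinv_0_lt_compat.
    rewrite Rinv_inv; lra.
  have [dl [Hdl H]] := Hdiff _ Heta.
  have [K [HK Hexp]] := F_expands_half_beam F HC HB.
  have [Hgz HFz] := Hg z Hz.
  exists (dl / K); split; first exact: Rdiv_lt_0_compat.
  move=> w Hw Hwz; have [Hgw HFw] := Hg w Hw.
  set h := vsub (g w) (g z).
  have Hh : norm h < dl.
    have H1 := Hexp _ _ Hgw Hgz; rewrite HFw HFz in H1.
    have H2 : K * dst w z < K * (dl / K) by apply: Rmult_lt_compat_l.
    have E : K * (dl / K) = dl by field; lra.
    rewrite /dst /Defs.dist -/h in H1 H2; lra.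
  have {H} := H h Hh; have -> : vadd (g z) h = g w by apply: vec_ext => j; rewrite !crdE; lra.
  rewrite HFw HFz => H.
  have H1 := ell_ge_norm A beta h Hlin Hell.
  have H2 : norm (A h) <= norm (vsub (vsub w z) (A h)) + norm (vsub w z).
    have := norm_le_dst (A h) (vsub w z); rewrite dst_sym /dst /Defs.dist; lra.
  rewrite /dst /Defs.dist -/h.
  have H3 : / M * norm h <= norm (vsub w z) by lra.
  have := Rmult_le_compat_l _ _ _ (Rlt_le _ _ HM0) H3.
  rewrite -Rmult_assoc Rinv_r; lra.
Qed.

Lemma inverse_lipschitz :
  almost_everywhere (fun x => exists A, diff_at F x A /\ ell_ge A beta) ->
  forall z w, 0 <= snd z -> 0 <= snd w ->
    dst (g z) (g w) <= / beta * rsum axes (fun j => Rabs (crd z j - crd w j)).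
Proof.
  move=> Hae z w Hz Hw.
  have [K [HK Hexp]] := F_expands_half_beam F HC HB.
  set s := rsum _ _.
  have Hs : 0 <= s by apply: rsum_ge0 => *; exact: Rabs_pos.
  have Hib := Rinv_0_lt_compat _ Hbeta.
  apply: le_epsilon => eps Heps.
  have He : 0 < eps / (s + 1) by apply: Rdiv_lt_0_compat; lra.
  (* Local dilation bounds are available only for constants above [/ beta]; the surplus chosen here
     costs at most [eps]. *)
  have : dst (g z) (g w) <= (/ beta + eps / (s + 1)) * s.
    apply: (lipschitz_l1 g K) => //; [lra|lra| |].
      move=> u v Hu Hv; have [Hu1 Hu2] := Hg u Hu; have [Hv1 Hv2] := Hg v Hv.
      by have := Hexp _ _ Hu1 Hv1; rewrite Hu2 Hv2.
    move=> r eps' Heps'.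
    (* Points of norm at most [r] have preimages of height at most [1 + r], where F is Lipschitz and
       carries the exceptional set to a set with small covers. *)
    have [K' [HK' Hlip]] := F_lipschitz_bounded F HC HB (1 + r).
    have [||L [HL1 [HL2 HL3]]] := null_image F (fun x => half_beam x /\ snd x <= 1 + r) K' _ _ _ eps' Hae Heps'.
    - lra.
    - by move=> x y [Hx1 Hx2] [Hy1 Hy2]; apply: Hlip.
    exists L; split=> //; split=> // u Hu Hur Hbad.
    have [Hu1 Hu2] := Hg u Hu; rewrite -Hu2; apply: HL3.
      by move=> HA; apply: Hbad; apply: inverse_dilates_le => //; lra.
    by split=> //; have := height_le_norm_F F HC HB _ Hu1; rewrite Hu2; lra.
  have : eps / (s + 1) * s <= eps.
    have {2}-> : eps = eps / (s + 1) * (s + 1) by field; lra.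
    by apply: Rmult_le_compat_l; lra.
  lra.
Qed.

End InverseLipschitz.

(** * Contractions of a half-space *)

Definition in_half_space {d} (s : bool) (x : vec d) : Prop :=
  if s then 0 <= snd x else snd x <= 0.

Lemma in_half_space_boundary {d} s (x : vec d) : snd x = 0 -> in_half_space s x.
Proof. by case: s => /= ->; lra. Qed.

(** Banach's fixed point theorem: the iterates of x form a Cauchy sequence, and the half-space is
    closed. *)
Lemma contraction_fixed_point {d : nat} (h : vec d -> vec d) s c x :
  (forall z, in_half_space s z -> in_half_space s (h z)) -> 0 <= c <= 1 / 2 ->
  (forall z w, in_half_space s z -> in_half_space s w -> dst (h z) (h w) <= c * dst z w) ->
  in_half_space s x ->
  exists w, h w = w /\ in_half_space s w /\ dst w x <= 2 * dst (h x) x.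
Proof.
  move=> Hmap Hc Hlip Hx.
  pose u k := Nat.iter k h x; pose D := dst (h x) x.
  have HD : 0 <= D by exact: dst_ge0.
  have Hu k : in_half_space s (u k) by elim: k => [|k IH] //=; exact: Hmap.
  have Hhalf z w : in_half_space s z -> in_half_space s w -> dst (h z) (h w) <= 1 / 2 * dst z w.
    move=> Hz Hw; apply: Rle_trans (Hlip _ _ Hz Hw) _.
    by apply: Rmult_le_compat_r; [exact: dst_ge0|lra].
  have Hstep k : dst (u (Datatypes.S k)) (u k) <= (1 / 2) ^ k * D.
    elim: k => [|k IH]; first by rewrite /= -/D; lra.
    apply: Rle_trans (Hhalf _ _ (Hu (Datatypes.S k)) (Hu k)) _.
    rewrite [(1 / 2) ^ Datatypes.S k]/=; lra.
  have Hfar k m : dst (u (m + k)%coq_nat) (u k) <= 2 * D * (1 / 2) ^ k * (1 - (1 / 2) ^ m).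
    elim: m => [|m IH]; first by rewrite /= dst_self; lra.
    apply: Rle_trans (dst_triangle (u (m + k)%coq_nat) _ _) _.
    have := Hstep (m + k)%coq_nat; rewrite pow_add [(1 / 2) ^ Datatypes.S m]/= /=; lra.
  have Hpow k : 0 < (1 / 2) ^ k by apply: pow_lt; lra.
  have Hcau k m : le k m -> dst (u m) (u k) <= 2 * D * (1 / 2) ^ k.
    move=> Hkm; have := Hfar k (m - k)%coq_nat; rewrite Nat.sub_add // => H.
    apply: Rle_trans H _; rewrite -{2}(Rmult_1_r (2 * D * _)).
    apply: Rmult_le_compat_l; first by have := Hpow k; nra.
    have := Hpow (m - k)%coq_nat; lra.
  have Hsmall B eps : 0 <= B -> 0 < eps -> exists N, B * (1 / 2) ^ N < eps.
    move=> HB He; have [||N HN] := pow_lt_1_zero (1 / 2) _ (eps / (B + 1)).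
    - by rewrite Rabs_pos_eq; lra.
    - by apply: Rdiv_lt_0_compat; lra.
    exists N; have {HN} := HN N (Nat.le_refl N).
    rewrite Rabs_pos_eq; last by left.
    move/(Rmult_lt_compat_l (B + 1) _ _ ltac:(lra)).
    have -> : (B + 1) * (eps / (B + 1)) = eps by field; lra.
    have := Hpow N; nra.
  have Hcrd j : Cauchy_crit (fun k => crd (u k) j).
    move=> eps Heps; have [|//|N HN] := Hsmall (4 * D) eps; first lra.
    exists N => m k Hm Hk; rewrite /Rdist.
    have H1 := Rle_trans _ _ _ (dst_crd _ _ j) (Hcau N m ltac:(lia)).
    have H2 := Rle_trans _ _ _ (dst_crd _ _ j) (Hcau N k ltac:(lia)).
    move: H1 H2; split_Rabs; lra.
  pose w : vec d := vec_of (fun j => proj1_sig (R_complete _ (Hcrd j))).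
  have Hw j : Un_cv (fun k => crd (u k) j) (crd w j).
    by rewrite crdE; exact: (proj2_sig (R_complete _ (Hcrd j))).
  pose n := INR (length (@axes d)); have Hn : 0 <= n by exact: pos_INR.
  (* The limit is taken coordinatewise, which costs the factor [n]; this affects only the rate of
     convergence. *)
  have Hlim k : dst (u k) w <= n * (2 * D) * (1 / 2) ^ k.
    apply: Rle_trans (dst_le_sum_abs _ _) _; rewrite /n Rmult_assoc -rsum_const.
    apply: rsum_le => j _; apply: le_epsilon => eps Heps.
    have [N HN] := Hw j _ Heps.
    have := HN (Nat.max N k) ltac:(lia); rewrite /Rdist.
    have := Rle_trans _ _ _ (dst_crd _ _ j) (Hcau k (Nat.max N k) ltac:(lia)).
    split_Rabs; lra.
  have Hws : in_half_space s w.
    have Hc0 N : Rabs (snd (u N) - snd w) <= n * (2 * D) * (1 / 2) ^ N.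
      exact: Rle_trans (dst_crd _ _ None) (Hlim N).
    move: Hu; rewrite /in_half_space; case: s {Hmap Hlip Hhalf Hx} => Hu; apply: Rnot_lt_le => Hneg.
      have [||N HN] := Hsmall (n * (2 * D)) (- snd w); [nra|lra|].
      have := Hc0 N; have := Hu N; split_Rabs; lra.
    have [||N HN] := Hsmall (n * (2 * D)) (snd w); [nra|lra|].
    have := Hc0 N; have := Hu N; split_Rabs; lra.
  have Hfix : h w = w.
    apply: dst_eq0; apply: le_epsilon => eps Heps.
    have [||N HN] := Hsmall (2 * (n * (2 * D))) eps; [nra|lra|].
    have := dst_triangle (h (u N)) (h w) w.
    have := Hhalf _ _ Hws (Hu N); rewrite dst_sym (dst_sym w).
    have := Hlim N; have := Hlim (Datatypes.S N); rewrite /= -/(u N).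
    have := Hpow N; have : 0 <= n * (2 * D) by nra.
    nra.
  (* The factor 2 comes from the fixed-point equation: [dst w x] is at most [dst (h x) x] plus half
     of itself. *)
  exists w; split=> //; split=> //.
  have := dst_triangle (h x) w x; rewrite -{2}Hfix.
  have := Hhalf _ _ Hws Hx; lra.
Qed.

(** * Reflections and inverse branches of S *)

Section Dynamics.
Context {d : nat}.
Variable F : vec d -> vec d.
Hypothesis HC : F_on_half_cube F.
Hypothesis HB : F_on_half_beam F.
Hypothesis HR : F_reflection F.
Variable g : vec d -> vec d.
Hypothesis Hg : forall z, 0 <= snd z -> half_beam (g z) /\ F (g z) = z.
Variables (beta lambda : R).
Hypothesis Hbeta : 0 < beta.
Hypothesis Hlambda : 0 < lambda.
Hypothesis Hlip : forall z w, 0 <= snd z -> 0 <= snd w ->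
  dst (g z) (g w) <= / beta * rsum axes (fun j => Rabs (crd z j - crd w j)).
Hypothesis Hexpand : sqrt (INR (d.-1).+1) < beta * lambda.
Variable j0 : 'I_(d.-1).

Let S x := vscale lambda (F x).
Let kappa := sqrt (INR (d.-1).+1) / (beta * lambda).

Definition tau_if (b : bool) (x : vec d) : vec d := if b then tau x else x.

Lemma tauK (x : vec d) : tau (tau x) = x.
Proof. by apply: vec_ext => -[i|] //=; lra. Qed.

Lemma tau_ifK b : involutive (tau_if b).
Proof. by case: b => x //=; exact: tauK. Qed.

Lemma dst_tau_if b x y : dst (tau_if b x) (tau_if b y) = dst x y.
Proof.
  case: b => //; apply: dst_congr => -[i|] //=.
  by rewrite -Rabs_Ropp; f_equal; lra.
Qed.

Lemma norm_tau_if b x : norm (tau_if b x) = norm x.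
Proof. by case: b => //; apply: norm_congr => -[i|] //=; rewrite Rabs_Ropp. Qed.

Lemma snd_tau_if0 b (x : vec d) : snd x = 0 -> snd (tau_if b x) = 0.
Proof. by case: b => //= ->; lra. Qed.

Lemma F_half_beam_upper x : half_beam x -> 0 <= snd (F x).
Proof.
  move=> Hx; rewrite (F_cap F HB) //=; case: HC => _ [H _].
  have [_ ] := H _ (half_cube_cap _ Hx); have := exp_excess_ge1 x; nra.
Qed.

(* [phi], with inverse [psi], is a composition of the reflections of the
   context; [b] is the parity of the number of factors and [e] tells whether
   the last coordinate is kept. *)
Definition folding (phi psi : vec d -> vec d) (b e : bool) : Prop :=
  cancel phi psi /\ cancel psi phi /\
  (forall x y, dst (psi x) (psi y) = dst x y) /\
  (forall x, F (phi x) = tau_if b (F x)) /\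
  (forall x, snd (psi x) = if e then snd x else - snd x).

Lemma refl_coordK j k : involutive (@refl_coord d j k).
Proof.
  move=> x; apply: vec_ext => -[i|] //=; case: eqP => [->|] //; lra.
Qed.

Lemma folding_id : folding idfun idfun false true.
Proof. by []. Qed.

Lemma folding_refl_coord phi psi b e j k : folding phi psi b e ->
  folding (refl_coord j k \o phi) (psi \o refl_coord j k) (~~ b) e.
Proof.
  move=> [H1 [H2 [H3 [H4 H5]]]]; split; [|split; [|split; [|split]]].
  - by move=> x /=; rewrite refl_coordK.
  - by move=> x /=; rewrite H2 refl_coordK.
  - move=> x y /=; rewrite H3; apply: dst_congr => -[i|] //=; case: eqP => _ //.
    by rewrite -Rabs_Ropp; f_equal; lra.
  - by move=> x /=; rewrite (proj1 HR) H4; case: b {H4} => //=; rewrite tauK.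
  - by move=> x /=; rewrite H5.
Qed.

Lemma folding_refl_last phi psi b e : folding phi psi b e ->
  folding (phi \o refl_last) (refl_last \o psi) (~~ b) (~~ e).
Proof.
  move=> [H1 [H2 [H3 [H4 H5]]]]; split; [|split; [|split; [|split]]].
  - by move=> x /=; rewrite H1; exact: tauK.
  - by move=> x /=; rewrite -[refl_last (refl_last _)]/(tau (tau _)) tauK H2.
  - by move=> x y /=; rewrite (dst_tau_if true) H3.
  - by move=> x /=; rewrite H4 (proj2 HR); case: b {H4} => //=; rewrite tauK.
  - by move=> x /=; rewrite H5; case: e {H5} => //=; lra.
Qed.

Lemma fold_horizontally x (l : list 'I_(d.-1)) : NoDup l ->
  exists phi psi b, folding phi psi b true /\
    (forall i, In i l -> -1 <= fst (phi x) i <= 1) /\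
    (forall i, ~ In i l -> fst (phi x) i = fst x i).
Proof.
  elim: l => [|j l IH] Hl.
    by exists idfun, idfun, false; split; [exact: folding_id|].
  have [Hj Hl'] := proj1 (NoDup_cons_iff _ _) Hl.
  have [phi [psi [b [Hf [H1 H2]]]]] := IH Hl'.
  have Hxj := H2 j Hj.
  have [Hm1 Hm2] := archimed ((fst x j - 1) / 2).
  (* With m the value of [up], the coordinate lies in the cell [2m - 1, 2m + 1]. For m = 2k + 1 one
     reflection brings it to [-1, 1]; for m = 2k two reflections compose to the translation by
     -4k. *)
  have [[k Hk]|[k Hk]] := Z.Even_or_Odd (up ((fst x j - 1) / 2)); rewrite Hk in Hm1 Hm2.
    exists (refl_coord j 0 \o (refl_coord j k \o phi)), ((psi \o refl_coord j k) \o refl_coord j 0), (~~ ~~ b).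
    split; first by do 2 apply: folding_refl_coord.
    rewrite mult_IZR in Hm1 Hm2.
    split=> [i [<-|Hi]|i Hi] /=.
    - by rewrite eqxx Hxj; lra.
    - by case: eqP => [E|_]; [rewrite -E in Hj|exact: H1].
    - by case: eqP => [E|_]; [case: Hi; left|apply: H2 => Hi'; apply: Hi; right].
  exists (refl_coord j k \o phi), (psi \o refl_coord j k), (~~ b).
  split; first exact: folding_refl_coord.
  rewrite plus_IZR mult_IZR in Hm1 Hm2.
  split=> [i [<-|Hi]|i Hi] /=.
  - by rewrite eqxx Hxj; lra.
  - by case: eqP => [E|_]; [rewrite -E in Hj|exact: H1].
  - by case: eqP => [E|_]; [case: Hi; left|apply: H2 => Hi'; apply: Hi; right].
Qed.

Lemma fold_into_half_beam x a : in_half_space a x ->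
  exists phi psi b, folding phi psi b a /\ half_beam (phi x).
Proof.
  have Hup y : 0 <= snd y -> exists phi psi b, folding phi psi b true /\ half_beam (phi y).
    move=> Hy; have [|phi [psi [b [Hf [H _]]]]] := fold_horizontally y (enum 'I_(d.-1)).
      by apply: NoDup_uniq; exact: enum_uniq.
    exists phi, psi, b; split=> //; split.
      by move=> i; apply: H; apply: in_mem; rewrite mem_enum.
    by case: Hf => [H1 [_ [_ [_ H5]]]]; rewrite -(H5 (phi y)) H1.
  case: a => /= Hx; first exact: Hup.
  have [|phi [psi [b [Hf H]]]] := Hup (refl_last x); first by rewrite /=; lra.
  exists (phi \o refl_last), (refl_last \o psi), (~~ b); split=> //.
  exact: (folding_refl_last _ _ _ true).
Qed.

(** The target half-space [a] is recorded so that branches can be composed and, when it equals the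
    domain [s], have fixed points. *)
Definition inverse_branch k (s a : bool) (h : vec d -> vec d) : Prop :=
  (forall z, in_half_space s z -> in_half_space a (h z) /\ Defs.iter S k (h z) = z) /\
  (forall z w, in_half_space s z -> in_half_space s w -> dst (h z) (h w) <= kappa ^ k * dst z w).

Lemma kappa_bounds : 0 < kappa < 1.
Proof.
  have H : 0 < sqrt (INR (d.-1).+1) by apply: sqrt_lt_R0; apply: lt_0_INR; lia.
  have Hbl : 0 < beta * lambda by exact: Rmult_lt_0_compat.
  split; first exact: Rdiv_lt_0_compat.
  apply: (Rmult_lt_reg_r (beta * lambda)) => //.
  have -> : kappa * (beta * lambda) = sqrt (INR (d.-1).+1) by rewrite /kappa; field; lra.
  lra.
Qed.

Lemma inverse_branch_comp k m s t a h1 h2 :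
  inverse_branch k s a h1 -> inverse_branch m t s h2 ->
  inverse_branch (m + k)%coq_nat t a (h1 \o h2).
Proof.
  move=> [H1 L1] [H2 L2]; split.
    move=> z /H2 [Hz Ez] /=; have [Ha E] := H1 _ Hz; split=> //.
    by rewrite /Defs.iter Nat.iter_add -/(Defs.iter S k _) E.
  move=> z w Hz Hw /=; have [Hz2 _] := H2 _ Hz; have [Hw2 _] := H2 _ Hw.
  apply: Rle_trans (L1 _ _ Hz2 Hw2) _; rewrite pow_add (Rmult_comm (kappa ^ m)) Rmult_assoc.
  apply: Rmult_le_compat_l; last exact: L2.
  by apply: pow_le; have := kappa_bounds; lra.
Qed.

(** The branch undoes in turn the scaling by [lambda], the sign given by the parity, the map F on
    the half-beam, and the folding. Reflections are isometries, so only g and the scaling enter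
    [kappa]. *)
Lemma inverse_branch_folding phi psi b a : folding phi psi b a ->
  exists h, inverse_branch 1 (~~ b) a h /\
    forall x, half_beam (phi x) -> in_half_space (~~ b) (S x) /\ h (S x) = x.
Proof.
  move=> [H1 [H2 [H3 [H4 H5]]]].
  have Hil : 0 < / lambda by exact: Rinv_0_lt_compat.
  have HSK z : vscale lambda (vscale (/ lambda) z) = z.
    by apply: vec_ext => j; rewrite !crdE -Rmult_assoc Rinv_r; lra.
  have HKS z : vscale (/ lambda) (vscale lambda z) = z.
    by apply: vec_ext => j; rewrite !crdE -Rmult_assoc Rinv_l; lra.
  have H4' x : F x = tau_if b (F (phi x)) by rewrite H4 tau_ifK.
  pose q z := tau_if b (vscale (/ lambda) z).
  have Hq z : in_half_space (~~ b) z -> 0 <= snd (q z).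
    by rewrite /q; case: b {H4 H4' q} => /=; nra.
  exists (fun z => psi (g (q z))); split; first split.
  - move=> z /Hq /Hg [Hb E]; split.
      by rewrite /in_half_space H5; case: Hb => _; case: (a); lra.
    by rewrite /= /S H4' H2 E /q tau_ifK HSK.
  - move=> z w /Hq Hz /Hq Hw; rewrite H3; apply: Rle_trans (Hlip _ _ Hz Hw) _.
    have Hsum := sum_abs_le_norm (vsub (q z) (q w)).
    rewrite (rsum_eq _ _ _ (fun j => Rabs (crd (q z) j - crd (q w) j))) in Hsum; last first.
      by move=> j _; rewrite crdE.
    rewrite -[norm _]/(dst (q z) (q w)) dst_tau_if dst_scale Rabs_pos_eq in Hsum; last lra.
    have Hib := Rinv_0_lt_compat _ Hbeta.
    apply: Rle_trans (Rmult_le_compat_l _ _ _ (Rlt_le _ _ Hib) Hsum) _.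
    by right; rewrite /kappa /=; field; lra.
  move=> x Hx; have HFx := F_half_beam_upper _ Hx; split.
    rewrite /S H4'; have : 0 <= lambda * snd (F (phi x)) by apply: Rmult_le_pos; lra.
    by case: (b) => /=; lra.
  have -> : q (S x) = F (phi x) by rewrite /q /S HKS H4.
  have [Hb E] := Hg _ HFx.
  by rewrite (F_inj_half_beam F HC HB _ _ Hb Hx E) H1.
Qed.

(** Each step appends the branch of a half-beam containing the current orbit point. The domain [s]
    is dictated by the orbit; freedom of choice comes from the next two lemmas. *)
Lemma inverse_branch_along_orbit n x a : in_half_space a x ->
  exists s h, inverse_branch n s a h /\ in_half_space s (Defs.iter S n x) /\
    h (Defs.iter S n x) = x.
Proof.
  move=> Hx; elim: n => [|n [s [h [Hh [Hs E]]]]].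
    exists a, idfun; split=> //; split=> // z w _ _ /=; lra.
  have [phi [psi [b [Hf Hb]]]] := fold_into_half_beam _ _ Hs.
  have [h1 [Hh1 H]] := inverse_branch_folding _ _ _ _ Hf.
  have [Hs1 E1] := H _ Hb.
  exists (~~ b), (h \o h1); split; first exact: (inverse_branch_comp n 1 s).
  by split=> //; rewrite -[Defs.iter S n.+1 x]/(S (Defs.iter S n x)) /= E1.
Qed.

(* On a vertical face two half-beams with images in opposite half-spaces meet,
   whence an inverse branch from either half-space. *)
Lemma nearby_face_point x a : in_half_space a x ->
  exists p, dst p x <= 2 /\ in_half_space a p /\ snd (S p) = 0 /\
    forall s, exists h, inverse_branch 1 s a h /\ h (S p) = p.
Proof.
  move=> Hx; have [phi [psi [b [Hf Hb]]]] := fold_into_half_beam _ _ Hx.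
  have [H1 [H2 [H3 [H4 H5]]]] := Hf.
  (* Moving one horizontal coordinate within [-1, 1] to 1 costs at most 2. The new point is fixed by
     the reflection in that face, so its image is fixed by [tau] and lies in H_0. *)
  pose y := set_crd (phi x) (Some j0) 1.
  have Hy : half_beam y.
    split; last by case: Hb.
    by move=> i /=; rewrite /upd; case: eqP => _; [lra|exact: (proj1 Hb i)].
  have Ey : refl_coord j0 0 y = y.
    apply: vec_ext => -[i|] //=; rewrite /upd; case: eqP => // ->; rewrite eqxx; lra.
  have HFy : snd (F y) = 0.
    have := f_equal snd (proj1 HR j0 0%Z y); rewrite Ey /=; lra.
  exists (psi y); split; [|split; [|split]].
  - rewrite -{1}(H1 x) H3.
    have {1}-> : phi x = set_crd (phi x) (Some j0) (fst (phi x) j0).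
      by apply: vec_ext => k; rewrite crd_set_crd; case: eqP => [->|].
    rewrite dst_set_crd; have := proj1 Hb j0; split_Rabs; lra.
  - rewrite /in_half_space H5; have := proj2 Hy; case: (a); lra.
  - rewrite /S; have -> : F (psi y) = tau_if b (F y) by rewrite -{2}(H2 y) H4 tau_ifK.
    by rewrite /= snd_tau_if0 //; lra.
  - move=> s; case: (boolP (s == ~~ b)) => [/eqP ->|Hs].
      have [h [Hh H]] := inverse_branch_folding _ _ _ _ Hf.
      by exists h; split=> //; apply: (proj2 (H _ _)); rewrite H2.
    (* The additional reflection fixes [y] and flips the parity, hence the half-space on which the
       branch is defined. *)
    have Hf' := folding_refl_coord _ _ _ _ j0 0%Z Hf.
    have [h [Hh H]] := inverse_branch_folding _ _ _ _ Hf'.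
    have -> : s = ~~ ~~ b by move: Hs; case: (s); case: (b).
    by exists h; split=> //; apply: (proj2 (H _ _)); rewrite /= H2 Ey.
Qed.

(** At a point of H_0 an upper and a lower half-beam meet, so either half-space can be the domain.
    The target [a] then depends on [s], which is why [nearby_face_point] provides branches from both
    half-spaces. *)
Lemma inverse_branch_at_base q s : snd q = 0 ->
  norm (S q) <= lambda /\ snd (S q) = 0 /\
  exists a h, inverse_branch 1 s a h /\ h (S q) = q.
Proof.
  move=> Hq; have [phi [psi [b [Hf Hb]]]] := fold_into_half_beam q true (in_half_space_boundary true _ Hq).
  have Eq : refl_last q = q by apply: vec_ext => -[i|] //=; rewrite Hq; lra.
  have [H1 [H2 [H3 [H4 H5]]]] := Hf.
  split; [|split].
  - rewrite norm_scale Rabs_pos_eq; last lra.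
    rewrite -(norm_tau_if b) -H4.
    have := norm_F F HC HB _ Hb.
    have -> : excess (phi q) = 0 by rewrite /excess -(H5 (phi q)) H1 Hq Rmax_left; lra.
    rewrite exp_0; nra.
  - have : snd (F q) = 0 by have := f_equal snd (proj2 HR q); rewrite Eq /=; lra.
    by move=> /= ->; lra.
  case: (boolP (s == ~~ b)) => [/eqP ->|Hs].
    have [h [Hh H]] := inverse_branch_folding _ _ _ _ Hf.
    by exists true, h; split=> //; apply: (proj2 (H _ _)).
  have Hf' := folding_refl_last _ _ _ _ Hf.
  have [h [Hh H]] := inverse_branch_folding _ _ _ _ Hf'.
  have -> : s = ~~ ~~ b by move: Hs; case: (s); case: (b).
  by exists false, h; split=> //; apply: (proj2 (H _ _)); rewrite /= Eq.
Qed.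

(** * Density of backward orbits and of periodic points *)

Lemma inverse_branch_approaching x a s z eps :
  in_half_space a x -> in_half_space s z -> 0 < eps ->
  exists k h, (1 <= k)%nat /\ inverse_branch k s a h /\ kappa ^ k <= 1 / 2 /\ dst (h z) x < eps.
Proof.
  move=> Hx Hz Heps; have [Hk0 Hk1] := kappa_bounds.
  (* [norm z + lambda] bounds the distance from z to S^2 p, and 2 bounds the distance from p to the
     orbit point. *)
  pose B := norm z + lambda + 2.
  have HB0 : 0 < B by rewrite /B; have := norm_ge0 z; lra.
  have [||N HN] := pow_lt_1_zero kappa _ (Rmin (1 / 2) (eps / B)).
  - by rewrite Rabs_pos_eq; lra.
  - by apply: Rmin_glb_lt; [lra|exact: Rdiv_lt_0_compat].
  have HkN : 0 < kappa ^ N by exact: pow_lt.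
  have {HN} := HN N (Nat.le_refl N); rewrite Rabs_pos_eq => [HN|]; last lra.
  have HN1 := Rmin_l (1 / 2) (eps / B); have HN2 := Rmin_r (1 / 2) (eps / B).
  have HN3 : kappa ^ N * B < eps.
    have : kappa ^ N * B < eps / B * B by apply: Rmult_lt_compat_r => //; lra.
    have -> : eps / B * B = eps by field; lra.
    by [].
  have [s0 [h0 [Hh0 [Hy E0]]]] := inverse_branch_along_orbit N x a Hx.
  have [p [Hp1 [Hp2 [Hp3 Hp4]]]] := nearby_face_point _ _ Hy.
  have [Hq1 [Hq2 [a1 [h2 [Hh2 E2]]]]] := inverse_branch_at_base (S p) s Hp3.
  have [h1 [Hh1 E1]] := Hp4 a1.
  have Hh01 := inverse_branch_comp _ _ _ _ _ _ _ Hh0 Hh1.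
  have Hh := inverse_branch_comp _ _ _ _ _ _ _ Hh01 Hh2.
  exists (1 + (1 + N))%coq_nat, ((h0 \o h1) \o h2); split=> //; split=> //.
  have Hkle : kappa ^ (1 + (1 + N))%coq_nat <= kappa ^ N.
    have : kappa * kappa * kappa ^ N <= 1 * kappa ^ N by apply: Rmult_le_compat_r; nra.
    rewrite !pow_add pow_1; lra.
  split; first lra.
  have H1 : dst (h0 (h1 (h2 z))) (h0 p) <= kappa ^ (1 + (1 + N))%coq_nat * dst z (S (S p)).
    rewrite -{1}E1 -{1}E2.
    exact: (proj2 Hh z (S (S p)) Hz (in_half_space_boundary s _ Hq2)).
  have H2 := proj2 Hh0 _ _ Hp2 Hy; rewrite E0 in H2.
  have H3 : dst z (S (S p)) <= norm z + lambda.
    have := dst_triangle vzero z (S (S p)); rewrite dst_vzero dst_sym (dst_sym vzero) !dst_vzero.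
    by rewrite (dst_sym (S (S p))); lra.
  have H4 := dst_triangle (h0 p) (h0 (h1 (h2 z))) x.
  have H5 : kappa ^ (1 + (1 + N))%coq_nat * dst z (S (S p)) <= kappa ^ N * (norm z + lambda).
    apply: Rmult_le_compat => //; [by apply: pow_le; lra|exact: dst_ge0].
  have H6 : kappa ^ N * dst p (Defs.iter S N x) <= kappa ^ N * 2.
    by apply: Rmult_le_compat_l; lra.
  rewrite /B in HN3; rewrite /=; lra.
Qed.

Lemma half_space_cases (x : vec d) : exists a, in_half_space a x.
Proof. by case: (Rle_dec 0 (snd x)) => H; [exists true|exists false; rewrite /=; lra]. Qed.

Lemma backward_orbit_dense z : dense (backward_orbit S z).
Proof.
  move=> x eps Heps; have [a Ha] := half_space_cases x; have [s Hs] := half_space_cases z.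
  have [k [h [_ [[H _] [_ Hd]]]]] := inverse_branch_approaching x a s z eps Ha Hs Heps.
  by exists (h z); split=> //; exists k; apply: (proj2 (H z Hs)).
Qed.

Lemma periodic_points_dense : dense (periodic_point S).
Proof.
  move=> x eps Heps; have [a Ha] := half_space_cases x.
  (* Domain and target agree here, and [eps / 2] allows for the factor 2 in
     [contraction_fixed_point]. *)
  have [|k [h [Hk [[H HL] [Hkap Hd]]]]] := inverse_branch_approaching x a a x (eps / 2) Ha Ha; first lra.
  have [||w [Hw1 [Hw2 Hw3]]] := contraction_fixed_point h a (kappa ^ k) x _ _ HL Ha.
  - by move=> z /H [].
  - by split=> //; apply: pow_le; have := kappa_bounds; lra.
  exists w; split.
    by exists k; split=> //; rewrite -{1}Hw1; apply: (proj2 (H w Hw2)).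
  by rewrite -/(dst w x); lra.
Qed.

(** The backward orbit of y meets the open set U. *)
Lemma blowing_up : blowing_up_everywhere S.
Proof.
  move=> U HU [u Hu] y; have [r [Hr HrU]] := HU u Hu.
  have [p [[k Hk] Hp]] := backward_orbit_dense y u r Hr.
  by exists k, p; split=> //; apply: HrU.
Qed.

End Dynamics.

Theorem theorem1p1 (d : nat) (hd : (2 <= d)%nat) (F : vec d -> vec d) (lambda : R) :
  F_on_half_cube F ->
  F_on_half_beam F ->
  F_reflection F ->
  (* beta := ess inf l(DF) > 0 and lambda > 4 sqrt(d-1) / beta *)
  (exists beta, 0 < beta /\
     almost_everywhere (fun x => exists A, diff_at F x A /\ ell_ge A beta) /\
     4 * sqrt (INR (d - 1)) / beta < lambda) ->
  let S := fun x => vscale lambda (F x) in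
  dense (periodic_point S) /\
  blowing_up_everywhere S /\
  (forall x, dense (backward_orbit S x)).
Proof.
  move=> HC HB HR [beta [Hbeta [Hae Hlam]]] S.
  have Hd : (0 < d.-1)%nat by case: d hd {F HC HB HR Hae Hlam S} => [|[|n]].
  rewrite subn1 in Hlam.
  have H1 : 1 <= INR d.-1 by apply: (le_INR 1); apply/leP.
  have Hs : 0 < sqrt (INR d.-1) by apply: sqrt_lt_R0; lra.
  have Hlambda : 0 < lambda.
    by apply: Rlt_trans Hlam; apply: Rdiv_lt_0_compat; lra.
  have Hexpand : sqrt (INR (d.-1).+1) < beta * lambda.
    have : 4 * sqrt (INR d.-1) / beta * beta < lambda * beta by exact: Rmult_lt_compat_r.
    have -> : 4 * sqrt (INR d.-1) / beta * beta = 4 * sqrt (INR d.-1) by field; lra.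
    (* Since d is at least 2, d <= 16 (d - 1). *)
    suff : sqrt (INR (d.-1).+1) <= 4 * sqrt (INR d.-1) by lra.
    have -> : 4 * sqrt (INR d.-1) = sqrt (16 * INR d.-1).
      rewrite sqrt_mult; [|lra|lra].
      have -> : 16 = 4 * 4 by lra.
      by rewrite sqrt_square; lra.
    by apply: sqrt_le_1_alt; rewrite S_INR; lra.
  have [g Hg] := half_beam_inverse_exists F HC HB.
  have Hlip := inverse_lipschitz F HC HB g Hg beta Hbeta Hae.
  (* A horizontal direction, and with it a vertical face, exists because d is at least 2. *)
  have j0 : 'I_(d.-1) := Ordinal Hd.
  split; [|split].
  - exact: (periodic_points_dense F HC HB HR g Hg beta).
  - exact: (blowing_up F HC HB HR g Hg beta).
  - exact: (backward_orbit_dense F HC HB HR g Hg beta).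
Qed.
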